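(* Let $n\ge2$, $A=(a_1,\dots,a_n)$ with integers $0<a_1<\cdots<a_n$, $\gcd(a_1,\dots,a_n)=1$, and $\beta\in\mathbb C$. Let $S_{n-1},S_n\subset\mathbb C^*$ be open sectors and let $\gamma$ be a rapid decay path relative to $S_{n-1}\times S_n$ such that $$I(\beta;x)=\int_\gamma t^{-\beta-1}\exp\Big(\sum_{j=1}^nx_jt^{a_j}\Big)dt$$ has, on $\mathbb C^{n-2}\times S_{n-1}\times S_n$ and for $x_n\to0$, the asymptotic expansion $\sum_{k\ge0}c_k(x_1,\dots,x_{n-1})x_n^k$ with $$c_k(x_1,\dots,x_{n-1})=\frac1{k!}\int_\gamma t^{-\beta-1+a_nk}\exp(x_1t^{a_1}+\cdots+x_{n-1}t^{a_{n-1}})\,dt .$$ Then this expansion is a Gevrey series of order less than or equal to $s=\frac{a_n}{a_{n-1}}$ with respect to $x_n=0$ (at every point of $\mathbb C^{n-2}\times S_{n-1}\times\{0\}$).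
   Context: Rapid decay path relative to $S_{n-1}\times S_n$: a piecewise $C^1$ path $\gamma:\mathbb R\to\mathbb C^*$ with $|\gamma(\tau)|\to\infty$ as $\tau\to\pm\infty$, with length in $\{|t|\le R\}$ growing at most polynomially in $R$, together with a continuous branch of $\log t$ along it, such that for all $(x_{n-1},x_n)\in S_{n-1}\times S_n$ the arguments (mod $2\pi$) of $x_{n-1}t^{a_{n-1}}$ and of $x_nt^{a_n}$, $t=\gamma(\tau)$, have limits in $]\frac\pi2,\frac{3\pi}2[$ both when $\tau\to+\infty$ and when $\tau\to-\infty$. Asymptotic expansion: for all $N$ and each fixed $(x_1,\dots,x_{n-1})$, $I(\beta;x)-\sum_{k\le N}c_kx_n^k=O(|x_n|^{N+1})$ as $x_n\to0$ in $S_n$. Gevrey: a formal series $\sum_{m\ge0}f_m(x_1,\dots,x_{n-1})x_n^m$, with all $f_m$ holomorphic on a common neighbourhood of $p'\in\mathbb C^{n-1}$, is Gevrey of order $\le s$ along $x_n=0$ at $(p',0)$ if $\sum_m\frac{f_m}{(m!)^{s-1}}x_n^m$ converges in a neighbourhood of $(p',0)$. *)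

(* Defs.v *)
From HB Require Import structures.
From mathcomp Require Export all_boot all_order all_algebra.
From mathcomp Require Export all_classical all_reals all_analysis.
From mathcomp Require Export complex.
Export Order.TTheory GRing.Theory Num.Theory numFieldNormedType.Exports.

Set Implicit Arguments.
Unset Strict Implicit.
Unset Printing Implicit Defensive.

Open Scope classical_set_scope.
Open Scope ring_scope.

(* R[i] itself carries no topology; its regular module R[i]^o is a normed
   module over the numClosedFieldType R[i]^o, so that continuity, filters and
   differentiability below are the library's, over the complex field. *)
Notation cplx R := ((complex R)^o).

Section ComplexFunctions.
Variable R : realType.
Implicit Types (z : cplx R) (tau : R).

Definition toC (r : R) : cplx R := Complex r 0.

(* The modulus as a real number; the generic norm `|z| lives in R[i]. *)
Definition cabs z : R := ComplexField.Normc.normc z.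

Definition expC z : cplx R :=
  toC (expR (complex.Re z)) * Complex (cos (complex.Im z)) (sin (complex.Im z)).

Definition polar (r theta : R) : cplx R :=
  toC r * Complex (cos theta) (sin theta).

Definition open_sector (S : set (cplx R)) : Prop :=
  exists lo hi : R, [/\ lo < hi, hi <= lo + 2 * pi &
    S = [set z | exists r theta : R,
           [/\ 0 < r, lo < theta, theta < hi & z = polar r theta]]].

(* Some determination phi of the argument of z (which is only defined
   modulo 2 pi) converges along F to a point of ]pi/2, 3 pi/2[. *)
Definition arg_cvg_left (F : set_system R) (z : R -> cplx R) : Prop :=
  exists (phi : R -> R) (theta : R),
    [/\ forall tau, z tau = polar (cabs (z tau)) (phi tau),
        phi @ F --> theta,
        pi / 2 < theta & theta < 3 * pi / 2].

End ComplexFunctions.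

Section Paths.
Variable R : realType.
Implicit Types (gamma lg : R -> cplx R) (tau : R).

Definition dpath gamma tau : cplx R :=
  Complex (derive1 (fun t : R => complex.Re (gamma t)) tau)
          (derive1 (fun t : R => complex.Im (gamma t)) tau).

(* D is the locally finite set of break points; the one-sided limits of the
   derivative say that gamma is C^1 on each closed piece. *)
Definition piecewise_C1 gamma : Prop :=
  continuous gamma /\
  exists D : set R,
    [/\ forall u v : R, finite_set (D `&` `[u, v]),
        forall tau, ~ D tau ->
          [/\ derivable (fun t : R => complex.Re (gamma t)) tau 1,
              derivable (fun t : R => complex.Im (gamma t)) tau 1 &
              {for tau, continuous (dpath gamma)}] &
        forall tau, D tau ->
          cvg (dpath gamma @ tau^'-) /\ cvg (dpath gamma @ tau^'+)].

(* Length of the part of the path contained in the disc of radius r. *)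
Definition length_in_disc gamma (r : R) : \bar R :=
  (\int[@lebesgue_measure R]_(tau in [set tau | (cabs (gamma tau) <= r)%R])
     (cabs (dpath gamma tau))%:E)%E.

(* lg is the branch of log t along the path; a1, a2 are the exponents
   a_{n-1}, a_n attached to the sectors S1 = S_{n-1}, S2 = S_n. *)
Record rapid_decay_path (a1 a2 : nat) (S1 S2 : set (cplx R)) gamma lg : Prop := {
  rd_piecewise_C1 : piecewise_C1 gamma;
  rd_neq0 : forall tau, gamma tau != 0;
  rd_pinfty : cabs (gamma tau) @[tau --> +oo] --> +oo;
  rd_ninfty : cabs (gamma tau) @[tau --> -oo] --> +oo;
  rd_length : exists (M : R) (d : nat), forall r : R, 1 <= r ->
    (length_in_disc gamma r <= (M * r ^+ d)%:E)%E;
  rd_log_continuous : continuous lg;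
  rd_log : forall tau, expC (lg tau) = gamma tau;
  rd_decay : forall x1 x2 : cplx R, S1 x1 -> S2 x2 ->
    [/\ arg_cvg_left +oo (fun tau => x1 * gamma tau ^+ a1),
        arg_cvg_left -oo (fun tau => x1 * gamma tau ^+ a1),
        arg_cvg_left +oo (fun tau => x2 * gamma tau ^+ a2) &
        arg_cvg_left -oo (fun tau => x2 * gamma tau ^+ a2)]
}.

(* \int_gamma f dt, the integrand f being given as a function of the parameter
   because powers of t depend on the branch of log t along the path. *)
Definition path_int gamma (f : R -> cplx R) : cplx R :=
  Complex
    (\int[@lebesgue_measure R]_tau complex.Re (f tau * dpath gamma tau))
    (\int[@lebesgue_measure R]_tau complex.Im (f tau * dpath gamma tau)).

Definition tpow lg (z : cplx R) tau : cplx R := expC (z * lg tau).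

End Paths.

Section Series.
Variables (R : realType) (m : nat).

(* (x_1, ..., x_{n-1}) and x_n give (x_1, ..., x_n), where n = m + 2. *)
Definition append (x' : 'rV[cplx R]_m.+1) (xn : cplx R) : 'rV[cplx R]_m.+2 :=
  \row_(j < m.+2) if unlift ord_max j is Some i then x' 0 i else xn.

Definition Iint (a : 'I_m.+2 -> nat) (beta : cplx R) (gamma lg : R -> cplx R)
    (x : 'rV[cplx R]_m.+2) : cplx R :=
  path_int gamma (fun tau =>
    tpow lg (- beta - 1) tau * expC (\sum_(j < m.+2) x 0 j * gamma tau ^+ a j)).

Definition coef (a : 'I_m.+2 -> nat) (beta : cplx R) (gamma lg : R -> cplx R)
    (k : nat) (x' : 'rV[cplx R]_m.+1) : cplx R :=
  (k`!%:R)^-1 * path_int gamma (fun tau =>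
    tpow lg (- beta - 1 + (a ord_max * k)%:R) tau *
    expC (\sum_(j < m.+1) x' 0 j * gamma tau ^+ a (lift ord_max j))).

Definition asymptotic_expansion (D : set 'rV[cplx R]_m.+1) (S : set (cplx R))
    (f : 'rV[cplx R]_m.+2 -> cplx R)
    (c : nat -> 'rV[cplx R]_m.+1 -> cplx R) : Prop :=
  forall (N : nat) (x' : 'rV[cplx R]_m.+1), D x' ->
    exists M : R, \forall xn \near within S (nbhs (0 : cplx R)),
      cabs (f (append x' xn) - \sum_(k < N.+1) c k x' * xn ^+ k)
        <= M * cabs xn ^+ N.+1.

(* Complex (Frechet) differentiability at every point of U. *)
Definition holomorphic_on (U : set 'rV[cplx R]_m.+1)
    (f : 'rV[cplx R]_m.+1 -> cplx R) : Prop :=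
  open U /\ forall x, U x -> differentiable f x.

(* Convergence of the series in a neighbourhood of (p', 0) is uniform
   convergence of the partial sums on some neighbourhood W, i.e. convergence to
   a germ of holomorphic function and not merely pointwise convergence. *)
Definition gevrey_order_le (s : R) (f : nat -> 'rV[cplx R]_m.+1 -> cplx R)
    (p' : 'rV[cplx R]_m.+1) : Prop :=
  exists U : set 'rV[cplx R]_m.+1,
    [/\ U p', forall k, holomorphic_on U (f k) &
      exists (W : set ('rV[cplx R]_m.+1 * cplx R))
             (g : 'rV[cplx R]_m.+1 * cplx R -> cplx R),
        [/\ nbhs (p', 0 : cplx R) W, W `<=` U `*` setT &
          {uniform W,
            (fun N (z : 'rV[cplx R]_m.+1 * cplx R) =>
               \sum_(k < N) f k z.1 / toC (k`!%:R `^ (s - 1)) * z.2 ^+ k)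
            @ \oo --> g}]].

End Series.

(* Main.v *)
Require Import Defs.
From mathcomp Require Import all_boot all_order all_algebra.
From mathcomp Require Import all_classical all_reals all_analysis.
From mathcomp Require Import complex.
From mathcomp Require Import measurable_realfun ring lra.
Import Order.TTheory GRing.Theory Num.Theory numFieldNormedType.Exports.

(** The theorem follows from one estimate along the path. Write r = |t| and
    a = a_{n-1}, N = a_n. Near both ends of the path the argument of
    p'_{n-1} t^a stays inside the left half plane, so Re(p'_{n-1} t^a) is at most
    - d r^a; the other exponents are smaller than a, and a compactness argument
    on the middle part of the path gives constants k > 0 and K with

      Re(sum_j p'_j t^{a_j}) + k (sum_j r^{a_j}) <= K

    along the whole path (phase_bound). Moving the parameters by at most k/4
    keeps three quarters of the decay, which is what makes everything uniform
    near p'.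

    Three facts turn this into bounds for the integrals. Powers of t with complex
    exponent are O(e^{c r}) for every c > 0, because the angle of log t is bounded:
    the lifted angle of p'_{n-1} t^a cannot turn by more than pi without leaving
    the left half plane (Im_log_bounded, cabs_tpow_le). The weight e^{-c r} is
    integrable against arc length, because the length inside radius R is
    polynomial in R (integrable_exp_weight). Finally u^j <= (j! / c^j) e^{c u},
    applied to u = r^a and raised to the power s = N / a, gives

      r^{N j} <= (j!)^s Q^j e^{c r^a},

    so the factor t^{N j} in the j-th coefficient costs (j!)^s Q^j and a small part
    of the decay (expn_le_gevrey, gevrey_cint_integrand). Dividing by
    j! (j!)^{s-1} = (j!)^s leaves a geometric series in x_n, converging uniformly
    for x_n small.

    Each coefficient is holomorphic because |e^v - 1 - v| <= 5 |v|^2 e^{|v|}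
    bounds the second order remainder in the parameters by an integrable
    function (cabs_expC_sub_le, differentiable_cint_integrand). *)

Set Implicit Arguments.
Unset Strict Implicit.
Unset Printing Implicit Defensive.

Local Open Scope classical_set_scope.
Local Open Scope ring_scope.

(** * Modulus and exponential of complex numbers *)

Section ComplexPlane.
Variable R : realType.
Local Notation C := (cplx R).
Local Notation Re := (@complex.Re R).
Local Notation Im := (@complex.Im R).
Implicit Types (z w : C) (x y : R).

Lemma norm_cabs z : `|z| = toC (cabs z).
Proof. by []. Qed.

Lemma norm_le_toC z x : (`|z| <= toC x) = (cabs z <= x).
Proof. by rewrite norm_cabs; exact: lecR. Qed.

Lemma norm_lt_toC z x : (`|z| < toC x) = (cabs z < x).
Proof. by rewrite norm_cabs; exact: ltcR. Qed.

Lemma ler_toC (a b : R) : (toC a <= toC b) = (a <= b).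
Proof. exact: lecR. Qed.

Lemma toC_gt0 (e : R) : 0 < e -> 0 < toC e :> C.
Proof. by move=> e0; rewrite ltcE /= eqxx. Qed.

Lemma gt0_toC (e : C) : 0 < e -> exists2 x, 0 < x & e = toC x.
Proof.
by case: e => a b; rewrite ltcE /= => /andP[/eqP -> a0]; exists a.
Qed.

Lemma cabs_ge0 z : 0 <= cabs z.
Proof. by case: z => a b; exact: sqrtr_ge0. Qed.

Lemma cabsM z w : cabs (z * w) = cabs z * cabs w.
Proof. exact: ComplexField.Normc.normcM. Qed.

Lemma cabsV z : cabs (z^-1)%R = ((cabs z)^-1)%R.
Proof. exact: ComplexField.Normc.normcV. Qed.

Lemma cabsD z w : cabs (z + w) <= cabs z + cabs w.
Proof. exact: le_normcD. Qed.

Lemma cabsN z : cabs (- z) = cabs z.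
Proof. exact: normcN. Qed.

Lemma cabs0 : cabs (0 : C) = 0.
Proof. exact: ComplexField.Normc.normc0. Qed.

Lemma cabs1 : cabs (1 : C) = 1.
Proof. exact: ComplexField.Normc.normc1. Qed.

Lemma cabs_gt0 z : (0 < cabs z) = (z != 0).
Proof.
rewrite lt_def cabs_ge0 andbT; congr (~~ _); apply/eqP/eqP => [|->].
  exact: ComplexField.Normc.eq0_normc.
exact: cabs0.
Qed.

Lemma cabsX z n : cabs (z ^+ n) = cabs z ^+ n.
Proof.
by elim: n => [|n IH]; rewrite ?expr0 ?cabs1// !exprS cabsM IH.
Qed.

Lemma cabs_sum (I : Type) (r : seq I) (P : pred I) (F : I -> C) :
  cabs (\sum_(i <- r | P i) F i) <= \sum_(i <- r | P i) cabs (F i).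
Proof.
elim/big_ind2 : _ => [|z1 x1 z2 x2 h1 h2|//]; first by rewrite cabs0.
by rewrite (le_trans (cabsD _ _))// lerD.
Qed.

Lemma cabs_toC x : cabs (toC x) = `|x|.
Proof. by rewrite /cabs /= expr0n addr0 sqrtr_sqr. Qed.

Lemma cabs_nat n : cabs (n%:R : C) = n%:R.
Proof.
have -> : (n%:R : C) = toC n%:R.
  by rewrite /toC; symmetry; exact: (rmorph_nat (real_complex R)).
by rewrite cabs_toC ger0_norm.
Qed.

Lemma norm_Re_le z : `|Re z| <= cabs z.
Proof.
case: z => a b /=; rewrite -sqrtr_sqr ler_sqrt ?addr_ge0 ?sqr_ge0//.
by rewrite lerDl sqr_ge0.
Qed.

Lemma norm_Im_le z : `|Im z| <= cabs z.
Proof.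
case: z => a b /=; rewrite -sqrtr_sqr ler_sqrt ?addr_ge0 ?sqr_ge0//.
by rewrite lerDr sqr_ge0.
Qed.

Lemma cabs_le_ReIm z : cabs z <= `|Re z| + `|Im z|.
Proof.
case: z => a b /=; rewrite -[leRHS]ger0_norm ?addr_ge0// -sqrtr_sqr.
rewrite ler_sqrt ?sqr_ge0// sqrrD !real_normK ?num_real//.
by rewrite -addrA lerD2l lerDr mulrn_wge0// mulr_ge0.
Qed.

Lemma ReD z w : Re (z + w) = Re z + Re w.
Proof. by case: z w => [? ?] []. Qed.

Lemma ImD z w : Im (z + w) = Im z + Im w.
Proof. by case: z w => [? ?] []. Qed.

Lemma ReM z w : Re (z * w) = Re z * Re w - Im z * Im w.
Proof. by case: z w => [? ?] []. Qed.

Lemma ImM z w : Im (z * w) = Re z * Im w + Im z * Re w.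
Proof. by case: z w => [? ?] []. Qed.

Lemma Re_sum (I : Type) (r : seq I) (P : pred I) (F : I -> C) :
  Re (\sum_(i <- r | P i) F i) = \sum_(i <- r | P i) Re (F i).
Proof. exact: (big_morph _ ReD). Qed.

Lemma Im_sum (I : Type) (r : seq I) (P : pred I) (F : I -> C) :
  Im (\sum_(i <- r | P i) F i) = \sum_(i <- r | P i) Im (F i).
Proof. exact: (big_morph _ ImD). Qed.

Lemma cabs_cis x : cabs (Complex (cos x) (sin x)) = 1.
Proof. by rewrite /cabs /= cos2Dsin2 sqrtr1. Qed.

Lemma cabs_expC z : cabs (expC z) = expR (Re z).
Proof. by rewrite /expC cabsM cabs_toC cabs_cis mulr1 ger0_norm// expR_ge0. Qed.

Lemma Re_expC z : Re (expC z) = expR (Re z) * cos (Im z).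
Proof. by rewrite /expC ReM /= mul0r subr0. Qed.

Lemma Im_expC z : Im (expC z) = expR (Re z) * sin (Im z).
Proof. by rewrite /expC ImM /= mul0r addr0. Qed.

Lemma complex_ext z w : Re z = Re w -> Im z = Im w -> z = w.
Proof. by case: z w => [a b] [c d] /= -> ->. Qed.

Lemma toCM (a b : R) : toC a * toC b = toC (a * b).
Proof. by apply: complex_ext; rewrite (ReM, ImM) /=; ring. Qed.

Lemma expCD z w : expC (z + w) = expC z * expC w.
Proof.
apply: complex_ext.
  by rewrite Re_expC ReM !Re_expC !Im_expC ReD ImD expRD cosD; ring.
by rewrite Im_expC ImM !Re_expC !Im_expC ReD ImD expRD sinD; ring.
Qed.

Lemma expC_natM n z : expC (n%:R * z) = expC z ^+ n.
Proof.
elim: n => [|n IH].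
  rewrite mul0r expr0; apply: complex_ext.
    by rewrite Re_expC /= expR0 cos0 mul1r.
  by rewrite Im_expC /= sin0 mulr0.
by rewrite -natr1 mulrDl mul1r expCD IH exprSr.
Qed.

Lemma norm_sin_le y : `|sin y| <= `|y|.
Proof.
have sinP (t : R) : 0 <= t -> `|sin t| <= t.
  move=> t0; have [|c _] := @MVT_segment R sin cos 0 t t0
      (fun x _ => is_derive_sin x).
    by apply: derivable_within_continuous => x _; exact: ex_derive.
  rewrite sin0 !subr0 => ->; rewrite normrM (ger0_norm t0).
  by rewrite ler_piMl// cos_max.
have [y0|y0] := leP 0 y; first by rewrite (ger0_norm y0) sinP.
by rewrite -normrN -sinN (ltr0_norm y0) sinP// oppr_ge0 ltW.
Qed.

Lemma norm_cos_sub1_le y : `|cos y - 1| <= `|y|.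
Proof.
have cosP (t : R) : 0 <= t -> `|cos t - 1| <= t.
  move=> t0; have [|c _] := @MVT_segment R cos (fun x => - sin x) 0 t t0
      (fun x _ => is_derive_cos x).
    by apply: derivable_within_continuous => x _; exact: ex_derive.
  rewrite cos0 subr0 => ->; rewrite normrM (ger0_norm t0) normrN.
  by rewrite ler_piMl// sin_max.
have [y0|y0] := leP 0 y; first by rewrite (ger0_norm y0) cosP.
by rewrite -cosN (ltr0_norm y0) cosP// oppr_ge0 ltW.
Qed.

Lemma norm_cos_sub1_le2 y : `|cos y - 1| <= y ^+ 2.
Proof.
have -> : cos y - 1 = - (sin (y / 2) ^+ 2) *+ 2.
  rewrite [in LHS](_ : y = (y / 2) *+ 2); last by rewrite -mulr_natr divfK.
  by rewrite cos_mulr2n cos2sin2; ring.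
have := norm_sin_le (y / 2); rewrite -(ler_pXn2r (n := 2))// ?nnegrE//.
rewrite !real_normK ?num_real// => h.
rewrite mulNrn normrN ger0_norm ?mulrn_wge0 ?sqr_ge0//.
have := sqr_ge0 y; have -> : y ^+ 2 = 4 * (y / 2) ^+ 2 by field.
by lra.
Qed.

Lemma norm_sin_subid_le y : `|sin y - y| <= y ^+ 2.
Proof.
have sinP (t : R) : 0 <= t -> `|sin t - t| <= t ^+ 2.
  move=> t0; have [|c] := @MVT_segment R (sin - id) (cos - cst 1) 0 t t0.
    by apply: derivable_within_continuous => x _; exact: ex_derive.
  rewrite in_itv /= => /andP[c0 ct]; rewrite !fctE sin0 !subr0 => ->.
  rewrite normrM (ger0_norm t0) expr2 ler_wpM2r//.
  by rewrite (le_trans (norm_cos_sub1_le c))// ger0_norm.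
have [y0|y0] := leP 0 y; first exact: sinP.
by rewrite -normrN opprD -sinN -sqrrN sinP// oppr_ge0 ltW.
Qed.

Lemma norm_expR_sub1_id_le x : `|expR x - 1 - x| <= x ^+ 2 * expR `|x|.
Proof.
have h1 : 0 <= expR x - 1 - x by have := expR_ge1Dx x; lra.
rewrite ger0_norm//.
have hN : expR x - 1 <= x * expR x.
  have := ler_wpM2r (expR_ge0 x) (expR_ge1Dx (- x)).
  by rewrite [leRHS]mulrC expRxMexpNx_1; lra.
have [x0|x0] := leP 0 x.
  rewrite ger0_norm// (@le_trans _ _ (x * (expR x - 1)))//; first by lra.
  by rewrite expr2 -mulrA ler_wpM2l.
rewrite ltr0_norm// (@le_trans _ _ (x ^+ 2))//.
  have := expR_ge1Dx x => h; have : 0 <= - x * (expR x - 1 - x) by nra.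
  by nra.
by rewrite ler_peMr ?sqr_ge0// -expR0 ler_expR; lra.
Qed.

(** For z = x + i y the remainder splits as
    (e^x - 1 - x) e^{iy} + x (e^{iy} - 1) + (e^{iy} - 1 - i y), and each summand
    is controlled by a real one-variable inequality. *)
Lemma cabs_expC_sub_le z :
  cabs (expC z - 1 - z) <= 5 * (cabs z ^+ 2 * expR (cabs z)).
Proof.
case: z => x y; set z := Complex x y; set c := Complex (cos y) (sin y).
have -> : expC z - 1 - z =
    toC (expR x - 1 - x) * c + toC x * Complex (cos y - 1) (sin y)
    + Complex (cos y - 1) (sin y - y).
  by apply: complex_ext; rewrite /expC /=; ring.
have xz : `|x| <= cabs z := norm_Re_le z.
have yz : `|y| <= cabs z := norm_Im_le z.
have x2 : x ^+ 2 <= cabs z ^+ 2.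
  by rewrite -(real_normK (num_real x)) lerXn2r// nnegrE ?cabs_ge0.
have y2 : y ^+ 2 <= cabs z ^+ 2.
  by rewrite -(real_normK (num_real y)) lerXn2r// nnegrE ?cabs_ge0.
have E1 : 1 <= expR (cabs z) by rewrite -expR0 ler_expR cabs_ge0.
have Ex : expR `|x| <= expR (cabs z) by rewrite ler_expR.
have t1 : cabs (toC (expR x - 1 - x) * c) <= cabs z ^+ 2 * expR (cabs z).
  rewrite cabsM cabs_cis mulr1 cabs_toC (le_trans (norm_expR_sub1_id_le x))//.
  by rewrite ler_pM ?sqr_ge0 ?expR_ge0.
have t2 : cabs (toC x * Complex (cos y - 1) (sin y)) <= 2 * cabs z ^+ 2.
  rewrite cabsM cabs_toC.
  have h : cabs (Complex (cos y - 1) (sin y)) <= 2 * cabs z.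
    apply: le_trans (cabs_le_ReIm _) _.
    rewrite -[leLHS]/(`|cos y - 1| + `|sin y|).
    by have := norm_cos_sub1_le y; have := norm_sin_le y; lra.
  rewrite [leRHS](_ : _ = cabs z * (2 * cabs z)); last by ring.
  by rewrite ler_pM// cabs_ge0.
have t3 : cabs (Complex (cos y - 1) (sin y - y)) <= 2 * cabs z ^+ 2.
  apply: le_trans (cabs_le_ReIm _) _.
  rewrite -[leLHS]/(`|cos y - 1| + `|sin y - y|).
  by have := norm_cos_sub1_le2 y; have := norm_sin_subid_le y; lra.
rewrite (le_trans (cabsD _ _))//.
have := cabsD (toC (expR x - 1 - x) * c) (toC x * Complex (cos y - 1) (sin y)).
have : cabs z ^+ 2 <= cabs z ^+ 2 * expR (cabs z) by rewrite ler_peMr ?sqr_ge0.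
by lra.
Qed.

End ComplexPlane.

(** * Measurability of complex functions on the line *)

Section Measurability.
Variable R : realType.
Local Notation C := (cplx R).
Local Notation Re := (@complex.Re R).
Local Notation Im := (@complex.Im R).
Implicit Types (F G : R -> C) (z : C).

Lemma cabs_lipschitz_continuous (f : C -> R) :
  (forall z w, `|f z - f w| <= cabs (z - w)) -> continuous f.
Proof.
move=> fL z; apply/(@cvgrPdist_lt _ _ _ (nbhs z) (nbhs_filter z)) => e e0.
near=> w; apply: le_lt_trans (fL z w) _; rewrite -norm_lt_toC.
by near: w; exists (toC e) => //; exact: toC_gt0.
Unshelve. all: by end_near. Qed.

Lemma Re_continuous : continuous (Re : C -> R).
Proof.
apply: cabs_lipschitz_continuous => z w.
by have := norm_Re_le (z - w); case: z w => [? ?] [].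
Qed.

Lemma Im_continuous : continuous (Im : C -> R).
Proof.
apply: cabs_lipschitz_continuous => z w.
by have := norm_Im_le (z - w); case: z w => [? ?] [].
Qed.

Lemma cabs_continuous : continuous (@cabs R).
Proof.
apply: cabs_lipschitz_continuous => z w; rewrite ler_norml.
have := cabsD (z - w) w; have := cabsD (w - z) z; rewrite !subrK.
by rewrite -[w - z]opprB cabsN => h1 h2; apply/andP; split; lra.
Qed.

Lemma locally_finite_countable (D : set R) :
  (forall u v : R, finite_set (D `&` `[u, v])) -> countable D.
Proof.
move=> Dfin; have -> : D = \bigcup_n (D `&` `[- n%:R, n%:R]).
  apply/seteqP; split => [x Dx|x [n _ []]//].
  exists (Num.truncn `|x|).+1 => //; split => //=.
  have /andP[_ /ltW] := truncn_itv (normr_ge0 x).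
  by rewrite in_itv /= ler_norml.
by apply: bigcup_countable => // n _; exact: finite_set_countable.
Qed.

Lemma locally_finite_open_setC (D : set R) :
  (forall u v : R, finite_set (D `&` `[u, v])) -> open (~` D).
Proof.
move=> Dfin; rewrite openE => x Dx; rewrite /interior.
have op : open (~` (D `&` `[x - 1, x + 1])).
  apply: closed_openC; apply: (accessible_finite_set_closed.1 _ _ (Dfin _ _)).
  exact: hausdorff_accessible.
have h : nbhs x (~` (D `&` `[x - 1, x + 1])).
  by apply: open_nbhs_nbhs; split => // -[].
near=> y => Dy; have : (~` (D `&` `[x - 1, x + 1])) y by near: y.
apply; split => //=; rewrite in_itv /=; have : `|x - y| < 1.
  by near: y; exact: nbhsx_ballx.
by rewrite ltr_norml => /andP[? ?]; apply/andP; split; lra.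
Unshelve. all: by end_near. Qed.

(** A real function continuous off a locally finite set is Borel: the exceptional
    set is countable and its complement is open. *)
Lemma measurable_fun_locally_finite (D : set R) (f : R -> R) :
  (forall u v : R, finite_set (D `&` `[u, v])) ->
  (forall t, ~ D t -> {for t, continuous f}) -> measurable_fun setT f.
Proof.
move=> Dfin fC.
have Dc := locally_finite_countable Dfin.
have meas1 (x : R) : measurable [set x] by exact: measurable_set1.
have mD : measurable D by exact: countable_measurable.
rewrite -(setvU D); apply/measurable_funU => //; first exact: measurableC.
split.
  apply: open_continuous_measurable_fun; first exact: locally_finite_open_setC.
  by move=> t; rewrite inE; exact: fC.
move=> _ Y mY; apply: countable_measurable => //.
exact: sub_countable (subset_card_le (@subIsetl _ _ _)) Dc.
Qed.

(** R[i] carries no sigma-algebra, so that measurability is asked of the two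
    coordinates; path integrals are defined by coordinates as well. *)
Definition cmeasurable F :=
  measurable_fun setT (fun t => Re (F t)) /\
  measurable_fun setT (fun t => Im (F t)).

Lemma cmeasurable_continuous F : continuous F -> cmeasurable F.
Proof.
move=> cF; split; apply: continuous_measurable_fun => t.
  by apply: continuous_comp; [exact: cF|exact: Re_continuous].
by apply: continuous_comp; [exact: cF|exact: Im_continuous].
Qed.

Lemma cmeasurable_cst z : cmeasurable (fun=> z).
Proof. by split; exact: measurable_cst. Qed.

Lemma cmeasurableD F G :
  cmeasurable F -> cmeasurable G -> cmeasurable (fun t => F t + G t).
Proof.
move=> [F1 F2] [G1 G2]; split.
  under eq_fun do rewrite ReD; exact: measurable_funD.
under eq_fun do rewrite ImD; exact: measurable_funD.
Qed.

Lemma cmeasurableM F G :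
  cmeasurable F -> cmeasurable G -> cmeasurable (fun t => F t * G t).
Proof.
move=> [F1 F2] [G1 G2]; split.
  under eq_fun do rewrite ReM.
  by apply: measurable_funB; apply: measurable_funM.
under eq_fun do rewrite ImM.
by apply: measurable_funD; apply: measurable_funM.
Qed.

Lemma cmeasurableX F n : cmeasurable F -> cmeasurable (fun t => F t ^+ n).
Proof.
move=> mF; elim: n => [|n IH].
  by under eq_fun do rewrite expr0; exact: cmeasurable_cst.
by under eq_fun do rewrite exprS; exact: cmeasurableM.
Qed.

Lemma cmeasurable_sum n (F : 'I_n -> R -> C) :
  (forall i, cmeasurable (F i)) -> cmeasurable (fun t => \sum_(i < n) F i t).
Proof.
elim: n F => [|n IH] F mF.
  by under eq_fun do rewrite big_ord0; exact: cmeasurable_cst.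
under eq_fun do rewrite big_ord_recr.
by apply: cmeasurableD => //; exact: IH.
Qed.

Lemma cmeasurable_expC F : cmeasurable F -> cmeasurable (fun t => expC (F t)).
Proof.
move=> [F1 F2]; have mcos : measurable_fun setT (@cos R).
  by apply: continuous_measurable_fun; exact: continuous_cos.
have msin : measurable_fun setT (@sin R).
  by apply: continuous_measurable_fun; exact: continuous_sin.
split.
  under eq_fun do rewrite Re_expC.
  by apply: measurable_funM; [exact: measurableT_comp|exact: measurableT_comp].
under eq_fun do rewrite Im_expC.
by apply: measurable_funM; [exact: measurableT_comp|exact: measurableT_comp].
Qed.

Lemma measurable_cabs F :
  cmeasurable F -> measurable_fun setT (fun t => cabs (F t)).
Proof.
move=> [F1 F2].
have -> : (fun t => cabs (F t)) =
    (fun t => Num.sqrt (Re (F t) ^+ 2 + Im (F t) ^+ 2)).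
  by apply/funext => t; rewrite /cabs; case: (F t).
apply: (@measurableT_comp _ _ _ _ _ _ (@Num.sqrt R)).
  by apply: continuous_measurable_fun; exact: sqrt_continuous.
by apply: measurable_funD; exact: measurable_funX.
Qed.

End Measurability.

(** * Integrals of complex functions on the line *)

Section ComplexIntegral.
Variable R : realType.
Local Notation C := (cplx R).
Local Notation Re := (@complex.Re R).
Local Notation Im := (@complex.Im R).
Local Notation mu := (@lebesgue_measure R).
Implicit Types (F G : R -> C) (g : R -> R) (z : C).

Definition cint F : C :=
  Complex (\int[mu]_t Re (F t)) (\int[mu]_t Im (F t)).

Definition cintegrable F :=
  mu.-integrable setT (EFin \o (fun t => Re (F t))) /\
  mu.-integrable setT (EFin \o (fun t => Im (F t))).

Lemma cintegrable_dominated F g : cmeasurable F ->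
  mu.-integrable setT (EFin \o g) -> (forall t, cabs (F t) <= g t) ->
  cintegrable F.
Proof.
move=> [F1 F2] ig Fg; split; apply: (le_integrable _ _ _ ig) => //.
- exact/measurable_EFinP.
- move=> t _ /=; rewrite lee_fin (le_trans (norm_Re_le _))//.
  by rewrite (le_trans (Fg t))// ler_norm.
- exact/measurable_EFinP.
- move=> t _ /=; rewrite lee_fin (le_trans (norm_Im_le _))//.
  by rewrite (le_trans (Fg t))// ler_norm.
Qed.

Lemma norm_Rintegral_dominated (f g : R -> R) :
  mu.-integrable setT (EFin \o f) -> mu.-integrable setT (EFin \o g) ->
  (forall t, `|f t| <= g t) -> `|\int[mu]_t f t| <= \int[mu]_t g t.
Proof.
move=> if_ ig fg; rewrite (le_trans (le_normr_Rintegral _ if_))//.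
apply: le_Rintegral => //; exact: integrable_norm.
Qed.

Lemma cabs_cint_le F g : cmeasurable F ->
  mu.-integrable setT (EFin \o g) -> (forall t, cabs (F t) <= g t) ->
  cabs (cint F) <= 2 * \int[mu]_t g t.
Proof.
move=> mF ig Fg; have [i1 i2] := cintegrable_dominated mF ig Fg.
apply: le_trans (cabs_le_ReIm _) _ => /=; rewrite mulrC mulr2n mulrDr mulr1.
apply: lerD; apply: norm_Rintegral_dominated => // t.
  exact: le_trans (norm_Re_le _) (Fg t).
exact: le_trans (norm_Im_le _) (Fg t).
Qed.

Lemma cintegrableD F G : cintegrable F -> cintegrable G ->
  cintegrable (fun t => F t + G t).
Proof.
move=> [F1 F2] [G1 G2]; split.
  rewrite (_ : EFin \o _ =
    (EFin \o (fun t => Re (F t))) \+ (EFin \o (fun t => Re (G t))))%E.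
    exact: integrableD.
  by apply/funext => t /=; rewrite ReD.
rewrite (_ : EFin \o _ =
  (EFin \o (fun t => Im (F t))) \+ (EFin \o (fun t => Im (G t))))%E.
  exact: integrableD.
by apply/funext => t /=; rewrite ImD.
Qed.

Lemma cintD F G : cintegrable F -> cintegrable G ->
  cint (fun t => F t + G t) = cint F + cint G.
Proof.
move=> [F1 F2] [G1 G2]; apply: complex_ext => /=.
  by under eq_Rintegral do rewrite ReD; exact: RintegralD.
by under eq_Rintegral do rewrite ImD; exact: RintegralD.
Qed.

Lemma integrable_mulr (r : R) (f : R -> R) :
  mu.-integrable setT (EFin \o f) ->
  mu.-integrable setT (EFin \o (fun t => r * f t)).
Proof.
move=> if_; rewrite (_ : EFin \o _ = (fun t => r%:E * (EFin \o f) t)%E)//.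
exact: integrableZl.
Qed.

Lemma cintegrableZ z F : cintegrable F -> cintegrable (fun t => z * F t).
Proof.
case: z => a b [F1 F2]; split.
  rewrite (_ : EFin \o _ = (EFin \o (fun t => (a * Re (F t))%R))
      \+ (EFin \o (fun t => (- b * Im (F t))%R)))%E.
    by apply: integrableD => //; exact: integrable_mulr.
  by apply/funext => t /=; rewrite ReM /= mulNr.
rewrite (_ : EFin \o _ = (EFin \o (fun t => (a * Im (F t))%R))
    \+ (EFin \o (fun t => (b * Re (F t))%R)))%E.
  by apply: integrableD => //; exact: integrable_mulr.
by apply/funext => t /=; rewrite ImM.
Qed.

Lemma cintZ z F : cintegrable F -> cint (fun t => z * F t) = z * cint F.
Proof.
case: z => a b [F1 F2]; apply: complex_ext; rewrite ?ReM ?ImM /=.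
  under eq_Rintegral do rewrite ReM /=.
  rewrite RintegralB//; [|exact: integrable_mulr..].
  by rewrite !RintegralZl.
under eq_Rintegral do rewrite ImM /=.
rewrite RintegralD//; [|exact: integrable_mulr..].
by rewrite !RintegralZl.
Qed.

Lemma cint0 : cint (fun=> 0) = 0.
Proof. by apply: complex_ext; rewrite /= Rintegral_cst//= mul0r. Qed.

Lemma cintegrable0 : cintegrable (fun=> 0).
Proof. by split; exact: integrable0. Qed.

Lemma cint_sum n (F : 'I_n -> R -> C) : (forall i, cintegrable (F i)) ->
  cintegrable (fun t => \sum_(i < n) F i t) /\
  cint (fun t => \sum_(i < n) F i t) = \sum_(i < n) cint (F i).
Proof.
elim: n F => [|n IH] F iF.
  rewrite big_ord0; under eq_fun do rewrite big_ord0.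
  by split; [exact: cintegrable0|exact: cint0].
rewrite big_ord_recr /=; under eq_fun do rewrite big_ord_recr /=.
have [i1 e1] := IH _ (fun i => iF (widen_ord (leqnSn n) i)).
by split; [exact: cintegrableD|rewrite cintD// e1].
Qed.

End ComplexIntegral.

(** * Exponential weights against arc length *)

Section ExponentialWeight.
Variable R : realType.
Local Notation mu := (@lebesgue_measure R).

Lemma expn_le_expR (c y : R) n : 0 < c -> 0 <= y ->
  y ^+ n <= n`!%:R / c ^+ n * expR (c * y).
Proof.
move=> c0 y0; have cy0 : 0 <= c * y by rewrite mulr_ge0// ltW.
have cn0 : 0 < c ^+ n by exact: exprn_gt0.
have h : (c * y) ^+ n / n`!%:R <= expR (c * y).
  case: n cn0 => [_|n _]; first by rewrite expr0 fact0 divr1 -expR0 ler_expR.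
  by have := expR_ge1Dxn n cy0; lra.
rewrite ler_pdivrMr ?ltr0n ?fact_gt0// exprMn -ler_pdivlMl// in h.
by rewrite (le_trans h)// le_eqVlt; apply/orP; left; apply/eqP; ring.
Qed.

(** Cutting the line along the shells j <= rho < j + 1 bounds the integral by
    the series of e^{-c j} times the length up to radius j + 1, in which the
    polynomial factor is absorbed by half of the exponential. *)
Lemma integrable_exp_weight (rho l : R -> R) (M c : R) (d : nat) : 0 < c ->
  measurable_fun setT rho -> measurable_fun setT l ->
  (forall t, 0 <= rho t) -> (forall t, 0 <= l t) ->
  (forall r : R, 1 <= r ->
    (\int[mu]_(t in [set t | (rho t <= r)%R]) (l t)%:E <= (M * r ^+ d)%:E)%E) ->
  mu.-integrable setT (EFin \o (fun t => expR (- (c * rho t)) * l t)).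
Proof.
move=> c0 mrho ml rho0 l0 hM.
have mg : measurable_fun setT (fun t => expR (- (c * rho t)) * l t).
  apply: measurable_funM => //; apply: measurableT_comp => //.
  by apply: measurableT_comp => //; exact: measurable_funM.
apply/integrableP; split; first exact/measurable_EFinP.
under eq_integral.
  move=> t _ /=; rewrite ger0_norm; last by rewrite mulr_ge0 ?expR_ge0.
  over.
pose A (j : nat) := [set t | rho t <= j.+1%:R].
have mA j : measurable (A j).
  by rewrite -[A j]setTI; exact: measurable_fun_le.
(* On the shell j <= rho < j + 1 the j-th term alone dominates the integrand. *)
pose f (j : nat) (t : R) : \bar R :=
  ((expR (- (c * j%:R)))%:E * ((EFin \o l) \_ (A j)) t)%E.
have l_ge0 j t : (0 <= ((EFin \o l) \_ (A j)) t)%E.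
  by rewrite patchE; case: ifP => // _; rewrite lee_fin.
have ml_patch j : measurable_fun setT ((EFin \o l) \_ (A j)).
  apply: (measurable_restrictT _ (mA j)).1; apply: measurable_funTS.
  exact/measurable_EFinP.
have f0 j t : (0 <= f j t)%E by rewrite mule_ge0// lee_fin expR_ge0.
have mf j : measurable_fun setT (f j).
  by apply: emeasurable_funM => //; exact: measurable_cst.
have le_f : (\int[mu]_t (expR (- (c * rho t)) * l t)%:E <=
    \int[mu]_t \sum_(0 <= j <oo) f j t)%E.
  apply: ge0_le_integral => //.
  - by move=> t _; rewrite lee_fin mulr_ge0 ?expR_ge0.
  - exact/measurable_EFinP.
  - by apply: ge0_emeasurable_sum => // j _; exact: mf.
  move=> t _; pose j := Num.truncn (rho t).
  have /andP[j1 j2] := truncn_itv (rho0 t).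
  apply: (@le_trans _ _ (f j t)).
    rewrite /f patchE mem_set; last exact: ltW.
    by rewrite -EFinM lee_fin ler_wpM2r// ler_expR lerN2 ler_pM2l.
  apply: le_trans (nneseries_lim_ge j.+1 _) => //.
  by rewrite big_nat_recr//= leeDr// sume_ge0.
apply: le_lt_trans le_f _; rewrite integral_nneseries//.
(* Half of the exponent absorbs (j + 1)^d and the other half is the ratio q. *)
pose K := `|M| * (d`!%:R / (c / 2) ^+ d * expR (c / 2)).
have K0 : 0 <= K.
  by rewrite !mulr_ge0 ?invr_ge0 ?exprn_ge0 ?expR_ge0 ?divr_ge0// ltW.
pose q := expR (- (c / 2)).
have q1 : `|q| < 1.
  by rewrite ger0_norm ?expR_ge0// -expR0 ltr_expR; lra.
have int_f j : (\int[mu]_t f j t <= (geometric K q j)%:E)%E.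
  rewrite /f ge0_integralZl_EFin// ?expR_ge0//; last exact: ml_patch.
  have -> : (\int[mu]_t ((EFin \o l) \_ (A j)) t =
      \int[mu]_(t in A j) (l t)%:E)%E by rewrite [RHS]integral_mkcond.
  have : (\int[mu]_(t in A j) (l t)%:E <= (`|M| * j.+1%:R ^+ d)%:E)%E.
    have := hM j.+1%:R; rewrite ler1n => /(_ isT) /le_trans; apply.
    by rewrite lee_fin ler_wpM2r ?exprn_ge0// ler_norm.
  move=> h; apply: le_trans (_ : _ <= (expR (- (c * j%:R)))%:E *
    (`|M| * j.+1%:R ^+ d)%:E)%E _.
    by rewrite lee_pmul2l// lte_fin expR_gt0.
  rewrite -EFinM lee_fin /geometric /=.
  have c2 : 0 < c / 2 by lra.
  have := expn_le_expR d c2 (ler0n R j.+1).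
  move=> /(ler_wpM2l (normr_ge0 M)) /(ler_wpM2l (expR_ge0 (- (c * j%:R)))).
  move=> /le_trans; apply; rewrite le_eqVlt; apply/orP; left; apply/eqP.
  rewrite /K /q -expRM_natr -!mulrA mulrCA; congr (_ * _).
  rewrite mulrCA; congr (_ * _); rewrite mulrCA; congr (_ * _).
  by rewrite -!expRD -natr1; congr expR; field.
apply: (@le_lt_trans _ _ (K / (1 - q))%:E); last exact: ltry.
apply: lime_le.
  by apply: is_cvg_nneseries => j _ _; exact: integral_ge0.
apply: nearW => n.
apply: le_trans (_ : _ <= \sum_(0 <= j < n) (geometric K q j)%:E)%E _.
  by apply: lee_sum => j _.
rewrite sumEFin lee_fin; apply: geometric_le_lim => //; exact: expR_gt0.
Qed.

End ExponentialWeight.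

(** * Behaviour of the logarithm along the path *)

Section ComplexContinuity.
Variable R : realType.
Local Notation C := (cplx R).
Implicit Types F G : R -> C.

Lemma continuous_cmul F G :
  continuous F -> continuous G -> continuous (fun t => F t * G t).
Proof. by move=> cF cG t; exact: (cvgM (cF t) (cG t)). Qed.

Lemma continuous_cpow F n : continuous F -> continuous (fun t => F t ^+ n).
Proof.
move=> cF; elim: n => [|n IH].
  by under eq_fun do rewrite expr0; move=> t; exact: cvg_cst.
by under eq_fun do rewrite exprS; exact: continuous_cmul.
Qed.

Lemma continuous_csum n (F : 'I_n -> R -> C) :
  (forall i, continuous (F i)) -> continuous (fun t => \sum_(i < n) F i t).
Proof.
elim: n F => [|n IH] F cF.
  by under eq_fun do rewrite big_ord0; move=> t; exact: cvg_cst.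
under eq_fun do rewrite big_ord_recr; move=> t.
by apply: cvgD; [exact: IH|exact: cF].
Qed.

Lemma continuous_Re F : continuous F -> continuous (fun t => complex.Re (F t)).
Proof.
by move=> cF t; apply: continuous_comp; [exact: cF|exact: Re_continuous].
Qed.

Lemma continuous_Im F : continuous F -> continuous (fun t => complex.Im (F t)).
Proof.
by move=> cF t; apply: continuous_comp; [exact: cF|exact: Im_continuous].
Qed.

Lemma continuous_cabs F : continuous F -> continuous (fun t => cabs (F t)).
Proof.
by move=> cF t; apply: continuous_comp; [exact: cF|exact: cabs_continuous].
Qed.

Lemma continuous_rpow (f : R -> R) n :
  continuous f -> continuous (fun t => f t ^+ n).
Proof.
by move=> cf t; apply: (@continuous_comp _ _ _ f (fun x => x ^+ n));
  [exact: cf|exact: exprn_continuous].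
Qed.

Lemma continuous_rsum n (f : 'I_n -> R -> R) :
  (forall i, continuous (f i)) -> continuous (fun t => \sum_(i < n) f i t).
Proof.
elim: n f => [|n IH] f cf.
  by under eq_fun do rewrite big_ord0; move=> t; exact: cvg_cst.
under eq_fun do rewrite big_ord_recr; move=> t.
by apply: cvgD; [exact: IH|exact: cf].
Qed.

End ComplexContinuity.

Section RealLine.
Variable R : realType.

Lemma near_pinfty_ray (P : R -> Prop) :
  (\forall t \near +oo, P t) -> exists b, forall t, b <= t -> P t.
Proof.
move=> [b [_ hb]]; exists (b + 1) => t bt; apply: hb.
by rewrite (lt_le_trans _ bt)// ltrDl.
Qed.

Lemma near_ninfty_ray (P : R -> Prop) :
  (\forall t \near -oo, P t) -> exists b, forall t, t <= b -> P t.
Proof.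
move=> [b [_ hb]]; exists (b - 1) => t bt; apply: hb.
by rewrite (le_lt_trans bt)// gtrBl.
Qed.

Lemma continuous_bounded_above (g : R -> R) (K1 K2 : R) : continuous g ->
  (\forall t \near +oo, g t <= K1) -> (\forall t \near -oo, g t <= K2) ->
  exists K, forall t, g t <= K.
Proof.
move=> cg /near_pinfty_ray[b hb] /near_ninfty_ray[a ha].
have [ab|ba] := leP a b; last first.
  exists (Num.max K1 K2) => t; rewrite le_max; have [tb|bt] := leP b t.
    by rewrite hb.
  by rewrite ha ?orbT// (le_trans (ltW bt))// ltW.
have [|c _ hc] := @EVT_max R g a b ab; first exact: continuous_subspaceT.
exists (Num.max (g c) (Num.max K1 K2)) => t; rewrite !le_max.
have [bt|tb] := leP b t; first by rewrite hb// !orbT.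
have [ta|lat] := leP t a; first by rewrite ha// !orbT.
by rewrite hc// in_itv /= !ltW.
Qed.

(** Along an interval where cos o h stays negative, h cannot move by more than pi:
    it would pass through h(a) + pi or h(a) - pi, where the cosine is the
    opposite of cos(h(a)). *)
Lemma cos_lt0_variation (h : R -> R) (a b : R) : a <= b -> continuous h ->
  (forall t, a <= t <= b -> cos (h t) < 0) -> `|h b - h a| <= pi.
Proof.
move=> ab ch hneg; rewrite leNgt; apply/negP => far.
have ha : cos (h a) < 0 by apply: hneg; rewrite lexx.
have chw : {within `[a, b], continuous h} by exact: continuous_subspaceT.
have pi0 := pi_gt0 R.
have [le_h|lt_h] := leP (h a) (h b).
  have [|c cab hc] := @IVT R h a b (h a + pi) ab chw.
    move: far; rewrite ger0_norm ?subr_ge0// => far.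
    by rewrite min_l// max_r//; apply/andP; split; lra.
  have := hneg c; rewrite hc cosDpi; move: cab; rewrite in_itv /= => -> /(_ isT).
  by lra.
have [|c cab hc] := @IVT R h a b (h a - pi) ab chw.
  move: far; rewrite ltr0_norm ?subr_lt0// => far.
  have hba := ltW lt_h.
  by rewrite min_r// max_l//; apply/andP; split; lra.
have := hneg c; rewrite hc; move: cab; rewrite in_itv /= => -> /(_ isT).
have -> : cos (h a - pi) = - cos (h a).
  by rewrite -[in RHS](subrK pi (h a)) cosDpi opprK.
by lra.
Qed.

End RealLine.

Section PathAsymptotics.
Variable R : realType.
Local Notation C := (cplx R).
Local Notation Re := (@complex.Re R).
Local Notation Im := (@complex.Im R).
Implicit Types (gamma lg : R -> C) (z : C).

Lemma Re_polar (r theta : R) : Re (polar r theta) = r * cos theta.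
Proof. by rewrite /polar ReM /= mul0r subr0. Qed.

Lemma Im_polar (r theta : R) : Im (polar r theta) = r * sin theta.
Proof. by rewrite /polar ImM /= mul0r addr0. Qed.

Lemma Re_natM n z : Re (n%:R * z) = n%:R * Re z.
Proof. by rewrite !mulr_natl; elim: n => [//|n IH]; rewrite !mulrS ReD IH. Qed.

Lemma Im_natM n z : Im (n%:R * z) = n%:R * Im z.
Proof. by rewrite !mulr_natl; elim: n => [//|n IH]; rewrite !mulrS ImD IH. Qed.

Lemma cabs_polar (r theta : R) : 0 <= r -> cabs (polar r theta) = r.
Proof. by move=> r0; rewrite /polar cabsM cabs_toC cabs_cis mulr1 ger0_norm. Qed.

(** The cosine of the limit angle is negative, so half of it is a rate of decay
    valid near the end. *)
Lemma arg_cvg_left_Re (F : set_system R) (FF : Filter F) (z : R -> C) :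
  arg_cvg_left F z ->
  exists2 d : R, 0 < d & \forall t \near F, Re (z t) <= - d * cabs (z t).
Proof.
move=> [phi [theta [zE phi_cvg h1 h2]]].
have cos0 : cos theta < 0.
  rewrite -[theta](subrK pi) cosDpi oppr_lt0 cos_gt0_pihalf//.
  by apply/andP; split; lra.
exists (- (cos theta / 2)); first by lra.
have cphi : (fun t => cos (phi t)) @ F --> cos theta.
  by apply: continuous_cvg => //; exact: continuous_cos.
have : \forall t \near F, cos (phi t) < cos theta / 2.
  by apply: (cvgr_lt _ cphi); lra.
apply: filterS => t; rewrite opprK => ht.
by rewrite [X in Re X]zE Re_polar mulrC ler_wpM2r ?cabs_ge0// ltW.
Qed.

Lemma open_sector_nonempty (S : set C) : open_sector S -> exists z, S z.
Proof.
move=> [lo [hi [lohi _ ->]]]; exists (polar 1 ((lo + hi) / 2)).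
by exists 1, ((lo + hi) / 2); split => //; lra.
Qed.

Lemma open_sector_polar (S : set C) z : open_sector S -> S z ->
  exists r alpha : R, 0 < r /\ z = polar r alpha.
Proof.
by move=> [lo [hi [_ _ ->]]] [r [th [r0 _ _ ->]]]; exists r, th.
Qed.

(** The real part of z t^n is negative near both ends, so the lifted angle
    arg z + n Im(log t) stays within pi of its value at the beginning of each
    end. *)
Lemma Im_log_bounded gamma lg n (r alpha : R) : (0 < n)%N -> 0 < r ->
  continuous lg -> (forall t, expC (lg t) = gamma t) ->
  (\forall t \near +oo, Re (polar r alpha * gamma t ^+ n) < 0) ->
  (\forall t \near -oo, Re (polar r alpha * gamma t ^+ n) < 0) ->
  exists K, forall t, `|Im (lg t)| <= K.
Proof.
move=> n0 r0 clg lgE hp hm.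
pose h (t : R) := alpha + n%:R * Im (lg t).
have ReE t : Re (polar r alpha * gamma t ^+ n) =
    r * expR (n%:R * Re (lg t)) * cos (h t).
  rewrite -lgE -expC_natM (ReM (polar r alpha)) Re_expC Im_expC.
  by rewrite Re_polar Im_polar Re_natM Im_natM /h cosD; ring.
have cos_lt0 t : Re (polar r alpha * gamma t ^+ n) < 0 -> cos (h t) < 0.
  by rewrite ReE pmulr_rlt0// mulr_gt0// expR_gt0.
have ch : continuous h.
  move=> t; apply: cvgD; first exact: cvg_cst.
  by apply: cvgM; [exact: cvg_cst|exact: continuous_Im].
have Im_le t : `|Im (lg t)| <= `|h t| + `|alpha|.
  have -> : `|Im (lg t)| = n%:R^-1 * `|h t - alpha|.
    rewrite /h addrAC subrr add0r normrM ger0_norm// mulKf//.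
    by rewrite pnatr_eq0 -lt0n.
  rewrite (le_trans (ler_piMl _ _))// ?ler_normB//.
  by rewrite invf_le1 ?ltr0n// ler1n.
have [b hb] := near_pinfty_ray hp; have [a ha] := near_ninfty_ray hm.
apply: (@continuous_bounded_above _ _ (pi + `|h b| + `|alpha|)
  (pi + `|h a| + `|alpha|)).
- by move=> t; apply: cvg_norm; exact: continuous_Im.
- near=> t; have bt : b <= t by near: t; apply: nbhs_pinfty_ge; exact: num_real.
  apply: le_trans (Im_le t) _; rewrite lerD2r.
  rewrite -[h t](subrK (h b)) (le_trans (ler_normD _ _))// lerD2r.
  by apply: cos_lt0_variation => // u /andP[bu _]; apply/cos_lt0/hb.
- near=> t; have ta : t <= a by near: t; apply: nbhs_ninfty_le; exact: num_real.
  apply: le_trans (Im_le t) _; rewrite lerD2r.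
  rewrite -[h t](subrK (h a)) (le_trans (ler_normD _ _))// lerD2r distrC.
  by apply: cos_lt0_variation => // u /andP[_ ua]; apply/cos_lt0/ha.
Unshelve. all: by end_near. Qed.

(** A power of t along the path grows slower than any exponential of |t|; the
    bound on the angle matters because the exponent is complex. *)
Lemma cabs_tpow_le gamma lg (K1 K2 c : R) z : 0 < c ->
  (forall t, expC (lg t) = gamma t) ->
  (forall t, `|Im (lg t)| <= K1) -> (forall t, - Re (lg t) <= K2) ->
  exists2 A : R, 0 <= A &
    forall t, cabs (tpow lg z t) <= A * expR (c * cabs (gamma t)).
Proof.
move=> c0 lgE hK1 hK2.
set b := `|Re z|; have b0 : 0 <= b by exact: normr_ge0.
(* From 1 + y - ln D <= e^y / D with D = (b + 1) / c: the logarithm of |t| costs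
   an arbitrarily small multiple of |t|. *)
pose K3 := b * `|K2| + (b + 1) * `|ln ((b + 1) / c)| + `|Im z| * K1.
exists (expR K3) => [|t]; first exact: expR_ge0.
rewrite /tpow cabs_expC -lgE cabs_expC -expRD ler_expR ReM.
set y := Re (lg t).
have h1 : Re z * y <= b * `|K2| + (b + 1) * `|ln ((b + 1) / c)| + c * expR y.
  rewrite (le_trans (ler_norm _))// normrM -/b.
  have [y0|y0] := leP 0 y.
    have bc : 0 < (b + 1) / c by apply: divr_gt0 => //; lra.
    have := expR_ge1Dx (y - ln ((b + 1) / c)).
    rewrite expRD expRN lnK ?posrE// invf_div => h.
    have h2 : (b + 1) * (1 + (y - ln ((b + 1) / c))) <= c * expR y.
      rewrite [leRHS](_ : _ = (b + 1) * (expR y * (c / (b + 1)))).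
        by rewrite ler_pM2l//; lra.
      by field; lra.
    have := ler_norm (ln ((b + 1) / c)).
    move=> /(ler_wpM2l (_ : 0 <= b + 1)) => /(_ ltac:(lra)) h3.
    have : 0 <= b * `|K2| by rewrite mulr_ge0.
    rewrite ger0_norm//; nra.
  rewrite ltr0_norm// -addrA (le_trans (_ : _ <= b * `|K2|))//.
    by rewrite ler_wpM2l// (le_trans (hK2 t))// ler_norm.
  by rewrite lerDl addr_ge0 ?mulr_ge0 ?expR_ge0// ?ltW//; lra.
have h2 : - (Im z * Im (lg t)) <= `|Im z| * K1.
  by rewrite (le_trans (ler_norm _))// normrN normrM ler_wpM2l.
by rewrite /K3; lra.
Qed.

End PathAsymptotics.

(** * Decay of the phase *)

Section PhaseBound.
Variables (R : realType) (n : nat) (e : 'I_n.+1 -> nat).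
Local Notation C := (cplx R).
Local Notation Re := (@complex.Re R).
Implicit Types (gamma : R -> C) (x : 'rV[C]_n.+1).

Definition phase gamma x t : C := \sum_(j < n.+1) x 0 j * gamma t ^+ e j.

Definition powsum gamma t : R := \sum_(j < n.+1) cabs (gamma t) ^+ e j.

Lemma powsum_ge gamma t j : cabs (gamma t) ^+ e j <= powsum gamma t.
Proof.
rewrite /powsum (bigD1 j)//= lerDl sumr_ge0// => i _.
by rewrite exprn_ge0// cabs_ge0.
Qed.

Lemma powsum_ge0 gamma t : 0 <= powsum gamma t.
Proof. by apply: sumr_ge0 => j _; rewrite exprn_ge0// cabs_ge0. Qed.

Lemma cabs_le_powsum gamma t : (0 < e ord_max)%N ->
  cabs (gamma t) <= powsum gamma t + 1.
Proof.
move=> e0; have r0 := cabs_ge0 (gamma t); have P0 := powsum_ge0 gamma t.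
have [r1|r1] := leP (cabs (gamma t)) 1; first by lra.
have := powsum_ge gamma t ord_max.
have : cabs (gamma t) <= cabs (gamma t) ^+ e ord_max.
  by rewrite -[leLHS]expr1 ler_weXn2l// ltW.
by lra.
Qed.

Lemma phaseD gamma x y t :
  phase gamma (x + y) t = phase gamma x t + phase gamma y t.
Proof.
rewrite /phase -big_split /=; apply: eq_bigr => j _.
by rewrite mxE mulrDl.
Qed.

Lemma cabs_phase_le gamma x t (d : R) : (forall j, cabs (x 0 j) <= d) ->
  cabs (phase gamma x t) <= d * powsum gamma t.
Proof.
move=> xd; rewrite (le_trans (cabs_sum _ _ _))// mulr_sumr ler_sum// => j _.
by rewrite cabsM cabsX ler_wpM2r// exprn_ge0// cabs_ge0.
Qed.

Lemma phase_continuous gamma x : continuous gamma -> continuous (phase gamma x).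
Proof.
move=> cg; apply: continuous_csum => j; apply: continuous_cmul.
  by move=> t; exact: cvg_cst.
exact: continuous_cpow.
Qed.

(** Towards an end of the path the top monomial dominates, since all others have
    smaller degree and |t| tends to infinity; half of its decay rate pays for
    them and for the whole of powsum. *)
Lemma phase_bound_end (F : set_system R) (FF : Filter F) gamma x (d : R) :
  (forall i : 'I_n, (e (widen_ord (leqnSn n) i) < e ord_max)%N) -> 0 < d ->
  cabs (gamma t) @[t --> F] --> +oo ->
  (\forall t \near F, Re (x 0 ord_max * gamma t ^+ e ord_max) <=
     - d * cabs (gamma t) ^+ e ord_max) ->
  \forall t \near F, Re (phase gamma x t) + d / 2 * powsum gamma t <= 0.
Proof.
move=> emax d0 ginf hmax; pose k := d / 2.
have k0 : 0 < k by rewrite divr_gt0.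
(* Once |t| >= S / k, the lower monomials with their coefficients add up to at
   most k |t|^{e_max}. *)
pose S := \sum_(i < n) (cabs (x 0 (widen_ord (leqnSn n) i)) + k).
have S0 : 0 <= S by apply: sumr_ge0 => i _; rewrite addr_ge0 ?cabs_ge0// ltW.
near=> t.
have r1 : 1 <= cabs (gamma t) by near: t; exact: (cvgryPge _).1.
have rS : S / k <= cabs (gamma t) by near: t; exact: (cvgryPge _).1.
have top : Re (x 0 ord_max * gamma t ^+ e ord_max) <=
    - d * cabs (gamma t) ^+ e ord_max by near: t.
set r := cabs (gamma t) in r1 rS top *.
rewrite /phase /powsum Re_sum !big_ord_recr /= -/k mulrDr addrACA.
have rpow i : r ^+ e (widen_ord (leqnSn n) i) <= r ^+ (e ord_max).-1.
  by rewrite ler_weXn2l// -ltnS prednK ?emax// (leq_ltn_trans _ (emax i)).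
have rmax0 : 0 <= r ^+ (e ord_max).-1 by rewrite exprn_ge0// cabs_ge0.
have low : \sum_(i < n) Re (x 0 (widen_ord (leqnSn n) i) *
      gamma t ^+ e (widen_ord (leqnSn n) i)) +
    k * (\sum_(i < n) r ^+ e (widen_ord (leqnSn n) i)) <=
    S * r ^+ (e ord_max).-1.
  rewrite mulr_sumr -big_split /= /S mulr_suml ler_sum// => i _.
  rewrite mulrDl; apply: lerD; last by apply: ler_wpM2l => //; exact: ltW.
  rewrite (le_trans (ler_norm _))// (le_trans (norm_Re_le _))// cabsM cabsX.
  by rewrite ler_wpM2l ?cabs_ge0.
have Sle : S * r ^+ (e ord_max).-1 <= k * r ^+ e ord_max.
  have [n0|n0] := posnP n.
    have -> : S = 0.
      by rewrite /S big1// => i _; have := ltn_ord i; rewrite [X in (_ < X)%N]n0.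
    by rewrite mul0r mulr_ge0 ?ltW// exprn_gt0// (lt_le_trans ltr01).
  have e0 : (0 < e ord_max)%N.
    exact: leq_ltn_trans (leq0n _) (emax (Ordinal n0)).
  rewrite -{2}(prednK e0) exprS mulrA ler_wpM2r//.
  by move: rS; rewrite ler_pdivrMr// mulrC.
have dk : d = k + k by rewrite /k -splitr.
apply: le_trans (lerD low (lexx _)) _; move: Sle top; rewrite dk mulNr mulrDl.
by lra.
Unshelve. all: by end_near. Qed.

(** The decisive estimate: along the whole path the real part of the phase is at
    most a constant minus a multiple of the sum of all |t|^{e_j}. Having the full
    sum on the right makes the estimate stable under small changes of all the
    parameters, with no reference to the sector. *)
Lemma phase_bound gamma x (d1 d2 : R) :
  (forall i : 'I_n, (e (widen_ord (leqnSn n) i) < e ord_max)%N) ->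
  0 < d1 -> 0 < d2 -> continuous gamma ->
  cabs (gamma t) @[t --> +oo] --> +oo -> cabs (gamma t) @[t --> -oo] --> +oo ->
  (\forall t \near +oo, Re (x 0 ord_max * gamma t ^+ e ord_max) <=
     - d1 * cabs (gamma t) ^+ e ord_max) ->
  (\forall t \near -oo, Re (x 0 ord_max * gamma t ^+ e ord_max) <=
     - d2 * cabs (gamma t) ^+ e ord_max) ->
  exists k K : R, 0 < k /\
    forall t, Re (phase gamma x t) + k * powsum gamma t <= K.
Proof.
move=> emax d10 d20 cg gp gm h1 h2; pose d := Num.min d1 d2.
have d0 : 0 < d by rewrite lt_min d10.
have [K hK] : exists K, forall t,
    Re (phase gamma x t) + d / 2 * powsum gamma t <= K.
  apply: (@continuous_bounded_above R _ 0 0).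
  - move=> t; apply: cvgD; first exact/continuous_Re/phase_continuous.
    apply: cvgM; first exact: cvg_cst.
    apply: continuous_rsum => j; exact/continuous_rpow/continuous_cabs.
  - apply: phase_bound_end => //; apply: filterS h1 => t /le_trans; apply.
    by rewrite ler_wpM2r ?exprn_ge0 ?cabs_ge0// lerN2 ge_min lexx.
  - apply: phase_bound_end => //; apply: filterS h2 => t /le_trans; apply.
    by rewrite ler_wpM2r ?exprn_ge0 ?cabs_ge0// lerN2 ge_min lexx orbT.
by exists (d / 2), K; split => //; rewrite divr_gt0.
Qed.

End PhaseBound.

(** * Frechet differentiability from a quadratic remainder *)

Section QuadraticRemainder.
Variables (R : realType) (n : nat).
Local Notation C := (cplx R).
Implicit Types (f : 'rV[C]_n.+1 -> C) (x h : 'rV[C]_n.+1).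

Lemma norm_coord_le h j : `|h 0 j| <= `|h|.
Proof.
rewrite [leRHS]/Num.Def.normr /= mx_normE -[leLHS]nngE num_le.
exact: (le_bigmax _ _ (0, j)).
Qed.

Lemma row_norm_toC h : exists2 d : R, 0 <= d & `|h| = toC d.
Proof.
have := normr_ge0 h; case: `|h| => a b; rewrite lecE /= => /andP[/eqP -> a0].
by exists a.
Qed.

Lemma cabs_coord_le h j (d : R) : `|h| = toC d -> cabs (h 0 j) <= d.
Proof. by move=> hd; rewrite -norm_le_toC -hd; exact: norm_coord_le. Qed.

Lemma differentiable_flat f x (B r : R) : 0 < r ->
  (forall h (d : R), 0 <= d <= r -> (forall j, cabs (h 0 j) <= d) ->
    cabs (f (x + h) - f x) <= B * d ^+ 2) ->
  differentiable f x.
Proof.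
move=> r0 fB.
have flat : f \o shift x = cst (f x) + \0 +o_ (0 : 'rV[C]_n.+1) id.
  apply/eqaddoP => eps /gt0_toC[s s0 ->]; near=> h.
  have [d d0 hd] := row_norm_toC h.
  have hj j : cabs (h 0 j) <= d := cabs_coord_le j hd.
  have dr : d <= Num.min r (s / (`|B| + 1)).
    have : `|h| <= toC (Num.min r (s / (`|B| + 1))).
      near: h; apply: (@nbhs0_le C (matrix C 1 n.+1 : normedModType C)).
      by apply: toC_gt0; rewrite lt_min r0 divr_gt0// ltr_wpDl.
    by rewrite hd ler_toC.
  move: dr; rewrite le_min => /andP[dr ds].
  have := fB h d; rewrite d0 dr => /(_ isT hj) h1.
  have -> : (f \o shift x - (cst (f x) + \0)) h = f (x + h) - f x.
    by rewrite -[LHS]/(f (h + x) - (f x + 0)) addr0 (addrC h).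
  rewrite hd toCM norm_le_toC; apply: (le_trans h1).
  have B1 : 0 < `|B| + 1 by rewrite ltr_wpDl.
  move: ds; rewrite ler_pdivlMr// => ds.
  by have := ler_norm B; nra.
apply/diff_locallyP; rewrite (diff_unique _ flat); last exact: cst_continuous.
by split => //; exact: cst_continuous.
Unshelve. all: by end_near. Qed.

(** A quadratically small remainder is a Frechet derivative: subtracting the
    candidate linear form leaves a function that is flat at x. *)
Lemma differentiable_quadratic_remainder f x (a : 'I_n.+1 -> C) (B r : R) :
  0 < r ->
  (forall h (d : R), 0 <= d <= r -> (forall j, cabs (h 0 j) <= d) ->
    cabs (f (x + h) - f x - \sum_(j < n.+1) h 0 j * a j) <= B * d ^+ 2) ->
  differentiable f x.
Proof.
move=> r0 fB; pose G := \sum_(j < n.+1) (fun y : 'rV[C]_n.+1 => y 0 j * a j : C).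
have GE y : G y = \sum_(j < n.+1) y 0 j * a j.
  by rewrite /G fct_sumE.
have dG : differentiable G x.
  apply: differentiable_sum => j.
  apply: (@differentiableM _ _ (fun y : 'rV[C]_n.+1 => y 0 j) (cst (a j))).
    exact: differentiable_coord.
  exact: differentiable_cst.
rewrite (_ : f = (f - G) + G); last by rewrite subrK.
apply: (differentiableD _ dG).
apply: (@differentiable_flat _ _ B r r0) => h d dr hj.
have -> : (f - G) (x + h) - (f - G) x =
    f (x + h) - f x - \sum_(j < n.+1) h 0 j * a j.
  rewrite -[(f - G) (x + h)]/(f (x + h) - G (x + h)) -[(f - G) x]/(f x - G x).
  rewrite !GE.
  have -> : \sum_(j < n.+1) (x + h) 0 j * a j =
      \sum_(j < n.+1) x 0 j * a j + \sum_(j < n.+1) h 0 j * a j.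
    by rewrite -big_split; apply: eq_bigr => j _; rewrite mxE mulrDl.
  by ring.
exact: fB.
Qed.

End QuadraticRemainder.

(** * Parameter dependence and growth of the integrals *)

Section GevreyGrowth.
Variable R : realType.

(** The s-th power of u^j <= (j! / c^j) e^{c u}, with u = r^a and s = N / a;
    this is where the order s of the series comes from. *)
Lemma expn_le_gevrey (N a : nat) (c : R) : (0 < N)%N -> (0 < a)%N -> 0 < c ->
  exists2 Q : R, 0 <= Q & forall (r : R) j, 0 <= r ->
    r ^+ (N * j) <= j`!%:R `^ (N%:R / a%:R) * Q ^+ j * expR (c * r ^+ a).
Proof.
move=> N0 a0 c0; pose s : R := N%:R / a%:R.
have s0 : 0 < s by rewrite divr_gt0 ?ltr0n.
pose b := (c / s)^-1; have b0 : 0 <= b by rewrite invr_ge0 divr_ge0 ?ltW.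
exists (b `^ s) => [|r j r0]; first exact: powR_ge0.
have u0 : 0 <= r ^+ a by exact: exprn_ge0.
have cs0 : 0 < c / s by rewrite divr_gt0.
have h := expn_le_expR j cs0 u0.
have hs := ge0_ler_powR (ltW s0) (exprn_ge0 j u0) (le_trans (exprn_ge0 j u0) h) h.
have -> : r ^+ (N * j) = (r ^+ a ^+ j) `^ s.
  rewrite -exprM -!powR_mulrn// -powRrM !natrM; congr (_ `^ _).
  by rewrite /s; field; rewrite pnatr_eq0 -lt0n.
apply: (le_trans hs); rewrite powRM ?expR_ge0//; last first.
  by rewrite divr_ge0// exprn_ge0// ltW.
rewrite -exprVn -/b powRM ?exprn_ge0// -expRM.
have -> : c / s * r ^+ a * s = c * r ^+ a by field; rewrite gt_eqF.
rewrite ler_wpM2r ?expR_ge0// ler_wpM2l ?powR_ge0//.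
rewrite -(powR_mulrn j b0) -powRrM mulrC powRrM powR_mulrn//.
exact: powR_ge0.
Qed.

End GevreyGrowth.

Section ParametricIntegral.
Variables (R : realType) (n : nat) (e : 'I_n.+1 -> nat).
Local Notation C := (cplx R).
Local Notation Re := (@complex.Re R).
Local Notation mu := (@lebesgue_measure R).
Variables (gamma lg : R -> C) (p : 'rV[C]_n.+1) (k K : R).
Implicit Types (x h : 'rV[C]_n.+1) (z : C).

Local Notation rho t := (cabs (gamma t)).
Local Notation speed t := (cabs (dpath gamma t)).
Local Notation P t := (powsum e gamma t).

Hypothesis k_gt0 : 0 < k.
Hypothesis e_gt0 : (0 < e ord_max)%N.
Hypothesis mgamma : cmeasurable gamma.
Hypothesis mlg : cmeasurable lg.
Hypothesis mdpath : cmeasurable (dpath gamma).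
Hypothesis lgE : forall t, expC (lg t) = gamma t.
Hypothesis weight_integrable : forall c : R, 0 < c ->
  mu.-integrable setT (EFin \o (fun t => expR (- (c * rho t)) * speed t)).
Hypothesis tpow_le : forall (c : R) z, 0 < c -> exists2 A : R, 0 <= A &
  forall t, cabs (tpow lg z t) <= A * expR (c * rho t).
Hypothesis phase_le : forall t, Re (phase e gamma p t) + k * P t <= K.

Definition integrand z x t : C :=
  tpow lg z t * expC (phase e gamma x t) * dpath gamma t.

Lemma cmeasurable_phase x : cmeasurable (phase e gamma x).
Proof.
apply: cmeasurable_sum => j.
by apply: cmeasurableM; [exact: cmeasurable_cst|exact: cmeasurableX].
Qed.

Lemma cmeasurable_integrand z x : cmeasurable (integrand z x).
Proof.
apply: cmeasurableM => //; apply: cmeasurableM; apply: cmeasurable_expC.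
  by apply: cmeasurableM => //; exact: cmeasurable_cst.
exact: cmeasurable_phase.
Qed.

(** Moving the parameters by at most k/4 costs a quarter of the decay of the
    phase, and the power of t an eighth. *)
Lemma integrand_le z : exists2 A : R, 0 <= A &
  forall x, (forall j, cabs (x 0 j - p 0 j) <= k / 4) ->
  forall t, cabs (integrand z x t) <= A * expR (- (5 / 8 * k * P t)) * speed t.
Proof.
have k8 : 0 < k / 8 by rewrite divr_gt0.
have [A A0 hA] := tpow_le z k8.
exists (A * expR (K + k / 8)); first by rewrite mulr_ge0// expR_ge0.
move=> x xp t; rewrite /integrand 2!cabsM ler_wpM2r ?cabs_ge0//.
rewrite cabs_expC -mulrA -expRD.
apply: (@le_trans _ _ (A * expR (k / 8 * rho t) * expR (Re (phase e gamma x t)))).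
  by rewrite ler_wpM2r ?expR_ge0.
rewrite -mulrA -expRD ler_wpM2l// ler_expR.
have -> : x = p + (x - p) by rewrite addrC subrK.
rewrite phaseD ReD.
have h1 : Re (phase e gamma (x - p) t) <= k / 4 * P t.
  rewrite (le_trans (ler_norm _))// (le_trans (norm_Re_le _))//.
  by apply: cabs_phase_le => j; rewrite !mxE.
have h2 : k / 8 * rho t <= k / 8 * (P t + 1).
  by rewrite ler_wpM2l ?(ltW k8)// cabs_le_powsum.
by have := phase_le t; lra.
Qed.

Let wint : R := 2 * (expR (k / 4) *
  \int[mu]_t (expR (- (k / 4 * rho t)) * speed t)).

(** Any decay rate below 5 k / 8 leaves room for polynomial factors; k / 4 is the
    rate that every integrand below retains. *)
Lemma decay_dominated (F : R -> C) (A : R) : cmeasurable F -> 0 <= A ->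
  (forall t, cabs (F t) <= A * expR (- (k / 4 * P t)) * speed t) ->
  cintegrable F /\ cabs (cint F) <= A * wint.
Proof.
move=> mF A0 hF; have k4 : 0 < k / 4 by rewrite divr_gt0.
have hg t : cabs (F t) <=
    A * expR (k / 4) * (expR (- (k / 4 * rho t)) * speed t).
  apply: (le_trans (hF t)); rewrite mulrA ler_wpM2r ?cabs_ge0// -!mulrA.
  rewrite ler_wpM2l// -expRD ler_expR.
  have : k / 4 * rho t <= k / 4 * (P t + 1).
    by rewrite ler_wpM2l ?(ltW k4)// cabs_le_powsum.
  by lra.
have ig := integrable_mulr (A * expR (k / 4)) (weight_integrable k4).
split; first exact: cintegrable_dominated ig hg.
apply: (le_trans (cabs_cint_le mF ig hg)).
rewrite RintegralZl//; last exact: weight_integrable.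
by rewrite /wint le_eqVlt; apply/orP; left; apply/eqP; ring.
Qed.

Lemma wint_ge0 : 0 <= wint.
Proof.
rewrite /wint !mulr_ge0 ?expR_ge0// Rintegral_ge0// => t _.
by rewrite mulr_ge0 ?expR_ge0// cabs_ge0.
Qed.

Lemma expR_powsum_le t (c d : R) :
  d <= c -> expR (- (c * P t)) <= expR (- (d * P t)).
Proof. by move=> dc; rewrite ler_expR lerN2 ler_wpM2r// powsum_ge0. Qed.

(** The remainder of e^{phase(h)} at order two is O(|h|^2) times an integrand that
    still decays, so differentiation under the integral sign needs no limit
    theorem. *)
Lemma differentiable_cint_integrand z x (r : R) :
  0 < r -> (forall j, cabs (x 0 j - p 0 j) <= k / 4 - r) ->
  differentiable (fun y => cint (integrand z y)) x.
Proof.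
move=> r0 xp; have [A A0 hA] := integrand_le z.
have xp4 j : cabs (x 0 j - p 0 j) <= k / 4.
  by rewrite (le_trans (xp j))// gerBl ltW.
have k8 : 0 < k / 8 by rewrite divr_gt0.
pose G j t := gamma t ^+ e j * integrand z x t.
have mG j : cmeasurable (G j).
  by apply: cmeasurableM; [exact: cmeasurableX|exact: cmeasurable_integrand].
have iG j : cintegrable (G j).
  apply: (decay_dominated (A := (k / 8)^-1 * A) (mG j) _ _).1.
    by rewrite mulr_ge0// invr_ge0 ltW.
  move=> t; rewrite /G cabsM cabsX.
  have h1 : rho t ^+ e j <= (k / 8)^-1 * expR (k / 8 * P t).
    rewrite (le_trans (powsum_ge e gamma t j))//.
    by have := expn_le_expR 1 k8 (powsum_ge0 e gamma t); rewrite !expr1 div1r.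
  apply: le_trans (ler_pM _ (cabs_ge0 _) h1 (hA x xp4 t)) _.
    by rewrite exprn_ge0// cabs_ge0.
  rewrite !mulrA ler_wpM2r ?cabs_ge0// [leLHS](_ : _ =
    (k / 8)^-1 * A * (expR (k / 8 * P t) * expR (- (5 / 8 * k * P t))));
    last by ring.
  rewrite ler_wpM2l ?mulr_ge0 ?invr_ge0 ?(ltW k8)// -expRD ler_expR.
  have kP : 0 <= k * P t by rewrite mulr_ge0 ?powsum_ge0// ltW.
  by lra.
have ii (y : 'rV[C]_n.+1) : (forall j, cabs (y 0 j - p 0 j) <= k / 4) ->
    cintegrable (integrand z y).
  move=> yp; apply: (decay_dominated (A := A) (cmeasurable_integrand z y) A0 _).1.
  move=> t; apply: (le_trans (hA y yp t)).
  rewrite ler_wpM2r ?cabs_ge0// ler_wpM2l// expR_powsum_le//.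
  by have := k_gt0; lra.
pose B := A * 5 * (2 / (k / 8) ^+ 2).
have B0 : 0 <= B by rewrite /B !mulr_ge0 ?invr_ge0 ?exprn_ge0// ltW.
have rk : r <= k / 4.
  by have := le_trans (cabs_ge0 _) (xp ord_max); rewrite subr_ge0.
apply: (@differentiable_quadratic_remainder _ _ _ x
  (fun j => cint (G j)) (B * wint) r r0) => h d /andP[d0 dr] hd.
have xh j : cabs ((x + h) 0 j - p 0 j) <= k / 4.
  rewrite mxE addrAC (le_trans (cabsD _ _))//.
  by have := xp j; have := hd j; lra.
have [iS cS] := cint_sum (fun j => cintegrableZ (h 0 j) (iG j)).
have -> : cint (integrand z (x + h)) - cint (integrand z x)
    - \sum_(j < n.+1) h 0 j * cint (G j) =
    cint (fun t => integrand z x t *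
      (expC (phase e gamma h t) - 1 - phase e gamma h t)).
  have -> : \sum_(j < n.+1) h 0 j * cint (G j) =
      cint (fun t => \sum_(j < n.+1) h 0 j * G j t).
    by rewrite cS; apply: eq_bigr => j _; rewrite cintZ.
  rewrite -[X in _ + X - _]mulN1r -cintZ; last exact: ii.
  rewrite -cintD; [|exact: ii|by apply: cintegrableZ; exact: ii].
  rewrite -[X in _ + X]mulN1r -cintZ// -cintD; last 2 first.
  - apply: cintegrableD; first exact: ii.
    by apply: cintegrableZ; exact: ii.
  - exact: cintegrableZ.
  congr cint; apply/funext => t; rewrite {1}/integrand phaseD expCD.
  have -> : \sum_(j < n.+1) h 0 j * G j t = phase e gamma h t * integrand z x t.
    by rewrite /phase mulr_suml; apply: eq_bigr => j _; rewrite /G mulrA.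
  by rewrite /integrand; ring.
rewrite [leRHS](_ : _ = (B * d ^+ 2) * wint); last by ring.
apply: (decay_dominated _ _ _).2.
- apply: cmeasurableM; first exact: cmeasurable_integrand.
  have mN1 : cmeasurable (fun=> -1 : C) by exact: cmeasurable_cst.
  apply: cmeasurableD.
    by apply: cmeasurableD => //; apply: cmeasurable_expC; exact: cmeasurable_phase.
  under eq_fun do rewrite -mulN1r.
  by apply: cmeasurableM => //; exact: cmeasurable_phase.
- by rewrite mulr_ge0 ?sqr_ge0.
move=> t; rewrite cabsM.
have hv := cabs_phase_le e gamma t hd.
set v := phase e gamma h t in hv *.
have P0 := powsum_ge0 e gamma t.
have h1 : cabs (expC v - 1 - v) <=
    5 * (d ^+ 2 * (2 / (k / 8) ^+ 2 * expR (k / 8 * P t)) * expR (k / 4 * P t)).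
  apply: (le_trans (cabs_expC_sub_le v)); rewrite ler_wpM2l//.
  apply: ler_pM; rewrite ?sqr_ge0 ?expR_ge0//.
    apply: (@le_trans _ _ ((d * P t) ^+ 2)).
      by rewrite lerXn2r ?nnegrE ?cabs_ge0// mulr_ge0.
    rewrite exprMn ler_wpM2l ?sqr_ge0//.
    by have := expn_le_expR 2 k8 P0.
  by rewrite ler_expR (le_trans hv)// ler_wpM2r// (le_trans dr).
apply: le_trans (ler_pM (cabs_ge0 _) (cabs_ge0 _) (hA x xp4 t) h1) _.
rewrite [leLHS](_ : _ = B * d ^+ 2 * (expR (- (5 / 8 * k * P t)) *
  expR (k / 8 * P t) * expR (k / 4 * P t)) * speed t); last first.
  by rewrite /B; ring.
have Bd0 : 0 <= B * d ^+ 2 by rewrite mulr_ge0 ?sqr_ge0.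
rewrite ler_wpM2r ?cabs_ge0//; apply: ler_wpM2l => //.
rewrite -!expRD ler_expR.
have kP : 0 <= k * P t by rewrite mulr_ge0// ltW.
by lra.
Qed.

Lemma integrand_addn z i x t :
  integrand (z + i%:R) x t = gamma t ^+ i * integrand z x t.
Proof. by rewrite /integrand /tpow mulrDl expCD expC_natM lgE; ring. Qed.

(** Multiplying the integrand by t^{N j} is paid for by another quarter of the
    decay of the phase, at the price of (j!)^s Q^j. *)
Lemma gevrey_cint_integrand z (N : nat) : (0 < N)%N ->
  exists A Q : R, [/\ 0 <= A, 0 <= Q &
    forall j x, (forall i, cabs (x 0 i - p 0 i) <= k / 4) ->
      cabs (cint (integrand (z + (N * j)%:R) x)) <=
        A * Q ^+ j * j`!%:R `^ (N%:R / (e ord_max)%:R)].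
Proof.
move=> N0; have [A A0 hA] := integrand_le z.
have k4 : 0 < k / 4 by rewrite divr_gt0.
have [Q Q0 hQ] := expn_le_gevrey N0 e_gt0 k4.
exists (A * wint), Q; split=> //; first by rewrite mulr_ge0 ?wint_ge0.
move=> j x xp; set f := j`!%:R `^ _.
have f0 : 0 <= f by exact: powR_ge0.
have D0 : 0 <= A * Q ^+ j * f by rewrite !mulr_ge0 ?exprn_ge0.
rewrite [leRHS](_ : _ = A * Q ^+ j * f * wint); last by ring.
apply: (decay_dominated (cmeasurable_integrand _ _) D0 _).2 => t.
rewrite integrand_addn cabsM cabsX.
apply: le_trans (ler_pM _ (cabs_ge0 _) (hQ _ j (cabs_ge0 (gamma t))) (hA x xp t)) _.
  by rewrite exprn_ge0// cabs_ge0.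
rewrite -/f [leLHS](_ : _ = A * Q ^+ j * f *
  (expR (k / 4 * rho t ^+ e ord_max) * expR (- (5 / 8 * k * P t))) * speed t);
  last by ring.
rewrite ler_wpM2r ?cabs_ge0//; apply: ler_wpM2l => //.
rewrite -expRD ler_expR.
have h1 : k / 4 * rho t ^+ e ord_max <= k / 4 * P t.
  by rewrite ler_wpM2l ?(ltW k4)// powsum_ge.
have kP : 0 <= k * P t by rewrite mulr_ge0 ?powsum_ge0// ltW.
by lra.
Qed.

End ParametricIntegral.

(** * Uniform convergence by a geometric majorant *)

Section UniformConvergence.
Variable R : realType.
Local Notation C := (cplx R).

Lemma geometric_tail (u : R^nat) (A : R) : (forall i, `|u i| <= A * 2^-1 ^+ i) ->
  forall N, `|limn (series u) - series u N| <= 2 * A * 2^-1 ^+ N.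
Proof.
move=> uA N.
have cu : cvgn (series u).
  apply: normed_cvg; apply: (@series_le_cvg _ _ (geometric A 2^-1)) => //.
  - by move=> i; exact: normr_ge0.
  - by move=> i; exact: le_trans (normr_ge0 _) (uA i).
  - by apply: is_cvg_geometric_series; rewrite ger0_norm//; lra.
have tail M : (N <= M)%N ->
    `|series u M - series u N| <= 2 * A * 2^-1 ^+ N - 2 * A * 2^-1 ^+ M.
  elim: M => [|M IH].
    by rewrite leqn0 => /eqP ->; rewrite !subrr normr0.
  rewrite leq_eqVlt => /orP[/eqP <-|]; first by rewrite !subrr normr0.
  rewrite ltnS => /IH h.
  have -> : series u M.+1 = series u M + u M by rewrite /series /= big_nat_recr.
  rewrite addrAC (le_trans (ler_normD _ _))// exprSr.
  by have := uA M; lra.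
have A0 : 0 <= A by have := le_trans (normr_ge0 _) (uA 0); rewrite expr0 mulr1.
have tail' M : (N <= M)%N ->
    `|series u M - series u N| <= 2 * A * 2^-1 ^+ N.
  move=> /tail /le_trans; apply; rewrite gerBl !mulr_ge0// exprn_ge0//.
rewrite ler_norml; apply/andP; split.
  rewrite lerBrDr; apply: limr_ge => //; near=> M.
  have /tail' : (N <= M)%N by near: M; exact: nbhs_infty_ge.
  by rewrite ler_norml => /andP[]; lra.
rewrite lerBlDr; apply: limr_le => //; near=> M.
have /tail' : (N <= M)%N by near: M; exact: nbhs_infty_ge.
by rewrite ler_norml => /andP[]; lra.
Unshelve. all: by end_near. Qed.

Lemma uniform_cvg_geometric (X : choiceType) (W : set X) (u : nat -> X -> C)
    (A : R) :
  (forall i x, W x -> cabs (u i x) <= A * 2^-1 ^+ i) ->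
  exists g : X -> C,
    {uniform W, (fun N x => \sum_(i < N) u i x) @ \oo --> g}.
Proof.
move=> uA; pose ur x i := complex.Re (u i x); pose ui x i := complex.Im (u i x).
exists (fun x => Complex (limn (series (ur x))) (limn (series (ui x)))).
set g := fun x => Complex _ _.
have gN N x : W x -> cabs (g x - \sum_(i < N) u i x) <= 4 * A * 2^-1 ^+ N.
  move=> Wx; apply: le_trans (cabs_le_ReIm _) _.
  have hr := @geometric_tail (ur x) A _ N; have hi := @geometric_tail (ui x) A _ N.
  have -> : complex.Re (g x - \sum_(i < N) u i x) =
      limn (series (ur x)) - series (ur x) N.
    rewrite -mulN1r ReD ReM /= Re_sum /series /= big_mkord.
    by rewrite oppr0 mul0r subr0 mulN1r.
  have -> : complex.Im (g x - \sum_(i < N) u i x) =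
      limn (series (ui x)) - series (ui x) N.
    rewrite -mulN1r ImD ImM /= Im_sum /series /= big_mkord.
    by rewrite oppr0 mul0r addr0 mulN1r.
  have := hr (fun i => le_trans (norm_Re_le _) (uA i x Wx)).
  have := hi (fun i => le_trans (norm_Im_le _) (uA i x Wx)).
  by lra.
move=> S /uniform_nbhs[E [entE ES]].
move: entE; rewrite -entourage_ballE => -[eps /= /gt0_toC[r r0 ->] rE].
near=> N; apply: ES => x Wx; apply: rE => /=.
rewrite -ball_normE /= norm_lt_toC (le_lt_trans (gN N x Wx))//.
near: N.
have h : (fun N => 4 * A * 2^-1 ^+ N) @ \oo --> (0 : R).
  by apply: cvg_geometric; rewrite ger0_norm//; lra.
by apply: (cvgr_lt _ h).
Unshelve. all: by end_near. Qed.

End UniformConvergence.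

(** * Rapid decay paths and the Gevrey estimate *)

Section RapidDecay.
Variables (R : realType) (a1 a2 : nat) (S1 S2 : set (cplx R)).
Variables (gamma lg : R -> cplx R).
Hypothesis hgamma : rapid_decay_path a1 a2 S1 S2 gamma lg.

Lemma rapid_decay_cmeasurable_dpath : cmeasurable (dpath gamma).
Proof.
have [_ [D [Dfin dC _]]] := rd_piecewise_C1 hgamma.
split; apply: (measurable_fun_locally_finite Dfin) => t /dC[_ _ ct].
  by apply: continuous_comp; [exact: ct|exact: Re_continuous].
by apply: continuous_comp; [exact: ct|exact: Im_continuous].
Qed.

Lemma rapid_decay_integrable (c : R) : 0 < c ->
  (@lebesgue_measure R).-integrable setT
    (EFin \o (fun t => expR (- (c * cabs (gamma t))) * cabs (dpath gamma t))).
Proof.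
move=> c0; have [M [d hM]] := rd_length hgamma.
apply: integrable_exp_weight hM => //.
- apply: measurable_cabs; apply: cmeasurable_continuous.
  by have [] := rd_piecewise_C1 hgamma.
- by apply: measurable_cabs; exact: rapid_decay_cmeasurable_dpath.
- by move=> t; exact: cabs_ge0.
- by move=> t; exact: cabs_ge0.
Qed.

Lemma rapid_decay_Re_le x1 x2 : open_sector S1 -> S1 x1 -> S2 x2 ->
  exists d1 d2 : R, [/\ 0 < d1, 0 < d2,
    \forall t \near +oo, complex.Re (x1 * gamma t ^+ a1) <=
      - d1 * cabs (gamma t) ^+ a1 &
    \forall t \near -oo, complex.Re (x1 * gamma t ^+ a1) <=
      - d2 * cabs (gamma t) ^+ a1].
Proof.
move=> hS1 Sx1 Sx2; have [r [alpha [r0 x1E]]] := open_sector_polar hS1 Sx1.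
have [hp hm _ _] := rd_decay hgamma Sx1 Sx2.
have [d1 d10 h1] := arg_cvg_left_Re _ hp.
have [d2 d20 h2] := arg_cvg_left_Re _ hm.
have cx1 : cabs x1 = r by rewrite x1E cabs_polar// ltW.
exists (d1 * r), (d2 * r); split; [exact: mulr_gt0|exact: mulr_gt0|..].
  by apply: filterS h1 => t; rewrite cabsM cabsX cx1 mulrA mulNr.
by apply: filterS h2 => t; rewrite cabsM cabsX cx1 mulrA mulNr.
Qed.

Lemma rapid_decay_tpow_le x1 x2 (c : R) z : (0 < a1)%N -> open_sector S1 ->
  S1 x1 -> S2 x2 -> 0 < c -> exists2 A : R, 0 <= A &
  forall t, cabs (tpow lg z t) <= A * expR (c * cabs (gamma t)).
Proof.
move=> a10 hS1 Sx1 Sx2 c0.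
have clg := rd_log_continuous hgamma; have lgE := rd_log hgamma.
have [r [alpha [r0 x1E]]] := open_sector_polar hS1 Sx1.
have [d1 [d2 [d10 d20 h1 h2]]] := rapid_decay_Re_le hS1 Sx1 Sx2.
have neg (d : R) t : 0 < d ->
    complex.Re (x1 * gamma t ^+ a1) <= - d * cabs (gamma t) ^+ a1 ->
    complex.Re (polar r alpha * gamma t ^+ a1) < 0.
  move=> d0; rewrite -x1E => /le_lt_trans; apply.
  by rewrite mulNr oppr_lt0 mulr_gt0// exprn_gt0// cabs_gt0 (rd_neq0 hgamma).
have [K1 hK1] : exists K, forall t, `|complex.Im (lg t)| <= K.
  apply: (@Im_log_bounded _ gamma lg a1 r alpha) => //.
    by apply: filterS h1 => t; exact: neg.
  by apply: filterS h2 => t; exact: neg.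
have ge1 (F : set_system R) : Filter F -> cabs (gamma t) @[t --> F] --> +oo ->
    \forall t \near F, - complex.Re (lg t) <= 0.
  move=> FF /cvgryPge /(_ 1); apply: filterS => t.
  by rewrite -lgE cabs_expC oppr_le0 -[1]expR0 ler_expR.
have [K2 hK2] : exists K, forall t, - complex.Re (lg t) <= K.
  apply: (@continuous_bounded_above R _ 0 0).
  - by move=> t; apply: cvgN; exact: continuous_Re.
  - exact: ge1 (rd_pinfty hgamma).
  - exact: ge1 (rd_ninfty hgamma).
exact: (cabs_tpow_le z c0 lgE hK1 hK2).
Qed.

End RapidDecay.

Theorem proposition4p1 (R : realType) (m : nat) (a : 'I_m.+2 -> nat)
    (a_pos : forall j, (0 < a j)%N)
    (a_incr : forall i j : 'I_m.+2, (i < j)%N -> (a i < a j)%N)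
    (a_gcd : \big[gcdn/0%N]_(j < m.+2) a j = 1%N)
    (beta : cplx R)
    (S1 S2 : set (cplx R)) (hS1 : open_sector S1) (hS2 : open_sector S2)
    (gamma lg : R -> cplx R)
    (hgamma : rapid_decay_path (a (lift ord_max ord_max)) (a ord_max)
                S1 S2 gamma lg)
    (hasympt : asymptotic_expansion
                 [set x' : 'rV[cplx R]_m.+1 | S1 (x' ord0 ord_max)] S2
                 (Iint a beta gamma lg) (coef a beta gamma lg)) :
  forall p' : 'rV[cplx R]_m.+1, S1 (p' ord0 ord_max) ->
    gevrey_order_le ((a ord_max)%:R / (a (lift ord_max ord_max))%:R)
      (coef a beta gamma lg) p'.
Proof.
move=> p Sp; pose e (j : 'I_m.+1) := a (lift ord_max j).
have [x2 Sx2] := open_sector_nonempty hS2.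
have e0 : (0 < e ord_max)%N by exact: a_pos.
have emax (i : 'I_m) : (e (widen_ord (leqnSn m) i) < e ord_max)%N.
  by apply: a_incr; rewrite !lift_max /=.
have [cgamma _] := rd_piecewise_C1 hgamma.
have [d1 [d2 [d10 d20 h1 h2]]] := rapid_decay_Re_le hgamma hS1 Sp Sx2.
have [k [K [k0 hK]]] := phase_bound (e := e) (x := p) emax d10 d20 cgamma
  (rd_pinfty hgamma) (rd_ninfty hgamma) h1 h2.
have mgamma := cmeasurable_continuous cgamma.
have mlg := cmeasurable_continuous (rd_log_continuous hgamma).
have mdp := rapid_decay_cmeasurable_dpath hgamma.
have lgE := rd_log hgamma.
have wint := rapid_decay_integrable hgamma.
have htp := fun c z =>
  @rapid_decay_tpow_le _ _ _ _ _ _ _ hgamma _ _ c z e0 hS1 Sp Sx2.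
have k8 : 0 < k / 8 by rewrite divr_gt0.
have coefE i : coef a beta gamma lg i = fun x =>
  (i`!%:R)^-1 * cint (integrand e gamma lg (- beta - 1 + (a ord_max * i)%:R) x).
  by [].
(* The estimates hold for parameters within k / 4 of p; radius k / 8 leaves a
   margin in which to differentiate. *)
pose U : set 'rV[cplx R]_m.+1 := ball p (toC (k / 8)).
have Uk x : U x -> forall j, cabs (x 0 j - p 0 j) <= k / 8.
  move=> [_ /(_ 0)] h j; have := h j; rewrite -ball_normE /= norm_lt_toC => /ltW.
  by rewrite -cabsN opprB.
have [A [Q [A0 Q0 hAQ]]] := gevrey_cint_integrand k0 e0 mgamma mlg mdp lgE wint
  htp hK (- beta - 1) (a_pos ord_max).
exists U; split.
- by apply: ballxx; exact: toC_gt0.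
- move=> i; split; first exact: ball_open.
  move=> x Ux; rewrite coefE.
  apply: (@differentiableM _ _ (cst _)); first exact: differentiable_cst.
  apply: (differentiable_cint_integrand k0 e0 mgamma mlg mdp wint htp hK _ k8).
  by move=> j; apply: le_trans (Uk x Ux j) _; lra.
(* With |z| < rho one has Q |z| <= 1/2. *)
pose rho := (2 * (Q + 1))^-1.
have rho0 : 0 < rho by rewrite invr_gt0 mulr_gt0// ltr_wpDl.
pose s : R := (a ord_max)%:R / (a (lift ord_max ord_max))%:R.
pose W : set ('rV[cplx R]_m.+1 * cplx R) := U `*` ball 0 (toC rho).
suff term_le i (y : 'rV[cplx R]_m.+1 * cplx R) : W y ->
    cabs (coef a beta gamma lg i y.1 / toC (i`!%:R `^ (s - 1)) * y.2 ^+ i)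
      <= A * 2^-1 ^+ i.
  have [g hg] := uniform_cvg_geometric term_le.
  exists W, g; split => //.
    exists (U, ball 0 (toC rho)) => //=; split; apply: nbhsx_ballx; exact: toC_gt0.
  by move=> z [].
case: y => x z [Ux zball]; have {zball} zr : cabs z < rho.
  by move: zball; rewrite -ball_normE /= sub0r normrN norm_lt_toC.
have f0 : 0 < i`!%:R :> R by rewrite ltr0n fact_gt0.
rewrite -[(x, z).1]/x -[(x, z).2]/z.
have k84 : k / 8 <= k / 4 by lra.
have := hAQ i x (fun j => le_trans (Uk x Ux j) k84).
rewrite -/e -[(a ord_max)%:R / _]/s coefE 3!cabsM cabsX 2!cabsV cabs_nat cabs_toC.
rewrite (ger0_norm (powR_ge0 _ _)).
set J := cabs (cint _) => hJ.
have g0 : 0 < i`!%:R `^ (s - 1) :> R by exact: powR_gt0.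
have fs : i`!%:R `^ s = i`!%:R * i`!%:R `^ (s - 1) :> R.
  rewrite -{2}(@powRr1 _ i`!%:R) ?(ltW f0)// -powRD; last first.
    by rewrite (gt_eqF f0) implybT.
  by rewrite addrC subrK.
rewrite fs in hJ; set f := i`!%:R in f0 g0 hJ *; set F := f `^ _ in g0 hJ *.
have hJ2 : f^-1 * J / F <= A * Q ^+ i.
  by rewrite ler_pdivrMr// mulrC ler_pdivrMr// (le_trans hJ)// le_eqVlt;
    apply/orP; left; apply/eqP; ring.
have Qz : Q * cabs z <= 2^-1.
  have : (Q + 1) * cabs z <= (Q + 1) * rho.
    by rewrite ler_wpM2l ?addr_ge0// ltW.
  have -> : (Q + 1) * rho = 2^-1 by rewrite /rho; field; rewrite gt_eqF// ltr_wpDl.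
  by have := cabs_ge0 z; lra.
apply: (@le_trans _ _ (A * Q ^+ i * cabs z ^+ i)).
  by rewrite ler_wpM2r// exprn_ge0// cabs_ge0.
rewrite -mulrA -exprMn ler_wpM2l// lerXn2r// nnegrE ?mulr_ge0 ?cabs_ge0//.
Qed.
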